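(* Let $k$ be an algebraically closed field, let $n\ge1$, and let $A_n=kC_n/I_n$. The indecomposable objects of the homotopy category $K(\operatorname{Inj}A_n)$ are, up to isomorphism, those of the form $I_{l,m}[r]$ with $r\in\mathbb{Z}$, $l\in\mathbb{Z}\cup\{-\infty\}$, $m\in\mathbb{Z}\cup\{+\infty\}$ and $l\le m$. Moreover, $I_{l,m}[r]= I_{l',m'}[r']$ (as isomorphism classes of objects) if and only if there is $q\in\mathbb{Z}$ with $l'=l+nq$, $m'=m+nq$ and $r'=r+nq$ (where $\pm\infty+nq=\pm\infty$).
   Context: $C_n$ is the cyclic quiver with vertices $1,\dots,n$ and one arrow $i\to i+1$ for each $i$ (indices modulo $n$; for $n=1$ a single loop), all arrows being denoted $\alpha$; the ideal of relations $I_n$ of $kC_n$ is generated by all paths $\alpha^2$ of length two. $A_n$-modules are identified with representations of $C_n$ satisfying these relations. For $1\le j\le n$ let $I_j$ be the indecomposable injective $A_n$-module with simple socle at vertex $j$ (indices modulo $n$, so $I_0=I_n$), and let $d_j:I_j\to I_{j-1}$ be the composite $I_j\to I_j/\operatorname{soc}I_j\cong\operatorname{rad}I_{j-1}\hookrightarrow I_{j-1}$. $I^{\bullet}$ is the periodic cochain complex $$\cdots\to I_n\xrightarrow{d_n}I_{n-1}\xrightarrow{d_{n-1}}I_{n-2}\to\cdots\to I_1\xrightarrow{d_1}I_n\to\cdots$$ with $I_1$ in degree $0$. $I_{l,m}=\sigma_{\le m}\sigma_{\ge l}I^{\bullet}$ is the brutal truncation: it has the terms and differentials of $I^\bullet$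 in degrees $i$ with $l\le i\le m$ and zero in other degrees. $[r]$ is the $r$-fold shift, $(X[r])^i=X^{i+r}$. $K(\operatorname{Inj}A_n)$ is the homotopy category of unbounded cochain complexes of arbitrary injective $A_n$-modules. *)

(* Defs.v *)
From HB Require Import structures.
From mathcomp Require Import all_boot all_order all_algebra.
From mathcomp Require Import constructive_ereal.

Set Implicit Arguments.
Unset Strict Implicit.
Unset Printing Implicit Defensive.

Import Order.TTheory GRing.Theory Num.Theory.
Local Open Scope ring_scope.

Section Representations.

Variables (k : fieldType) (n : nat).

(* A_n-modules of arbitrary dimension, as representations of the cyclic quiver
   with alpha^2 = 0.  The vertices 1, ..., n are encoded as residues modulo n,
   that is, as 'I_n with the vertex n being 0; [ordS i] is i + 1 modulo n. *)
Record rep := Rep {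
  rep_space :> 'I_n -> lmodType k;
  arrow : forall i, {linear rep_space i -> rep_space (ordS i)};
  arrow_arrow : forall i x, arrow (ordS i) (arrow i x) = 0 }.

Record rep_hom (M N : rep) := Hom {
  hom_map :> forall i, {linear M i -> N i};
  hom_arrow : forall i x,
    hom_map (ordS i) (arrow M i x) = arrow N i (hom_map i x) }.

Fact id_hom_arrow (M : rep) i (x : M i) : arrow M i x = arrow M i x.
Proof. by []. Qed.

Definition id_hom (M : rep) : rep_hom M M :=
  @Hom M M (fun i => idfun : {linear M i -> M i}) (@id_hom_arrow M).

Fact comp_hom_arrow (M N P : rep) (g : rep_hom N P) (f : rep_hom M N) i (x : M i) :
  g (ordS i) (f (ordS i) (arrow M i x)) = arrow P i (g i (f i x)).
Proof. by rewrite !hom_arrow. Qed.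

Definition comp_hom (M N P : rep) (g : rep_hom N P) (f : rep_hom M N) : rep_hom M P :=
  @Hom M P (fun i => g i \o f i : {linear M i -> P i}) (comp_hom_arrow g f).

Fact zero_hom_arrow (M N : rep) i (x : M i) : 0 = arrow N i 0.
Proof. by rewrite linear0. Qed.

Definition zero_hom (M N : rep) : rep_hom M N :=
  @Hom M N (fun i => \0 : {linear M i -> N i}) (@zero_hom_arrow M N).

Fact scale_hom_arrow (M N : rep) (c : k) (f : rep_hom M N) i (x : M i) :
  c *: f (ordS i) (arrow M i x) = arrow N i (c *: f i x).
Proof. by rewrite hom_arrow linearZ. Qed.

Definition scale_hom (M N : rep) (c : k) (f : rep_hom M N) : rep_hom M N :=
  @Hom M N (fun i => c \*: f i : {linear M i -> N i}) (scale_hom_arrow c f).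

Fact zero_rep_arrow (i : 'I_n) (x : 'rV[k]_0) : 0 = 0 :> 'rV[k]_0.
Proof. by []. Qed.

Definition zero_rep : rep :=
  @Rep (fun=> 'rV[k]_0) (fun=> \0) zero_rep_arrow.

Section DirectSum.

Variables M N : rep.

Definition sum_arrow_fun i (x : M i * N i) : M (ordS i) * N (ordS i) :=
  (arrow M i x.1, arrow N i x.2).

Fact sum_arrow_linear i : linear (@sum_arrow_fun i).
Proof. by move=> c x y; rewrite /sum_arrow_fun /= !linearP. Qed.

HB.instance Definition _ i :=
  GRing.isLinear.Build k (M i * N i)%type (M (ordS i) * N (ordS i))%type _
    (@sum_arrow_fun i) (@sum_arrow_linear i).

Fact sum_arrow_arrow i (x : M i * N i) :
  sum_arrow_fun (sum_arrow_fun x) = 0.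
Proof. by rewrite /sum_arrow_fun /= !arrow_arrow. Qed.

Definition rep_sum : rep :=
  @Rep (fun i => (M i * N i)%type) (fun i => @sum_arrow_fun i)
    sum_arrow_arrow.

End DirectSum.

Section SumHom.

Variables (M N M' N' : rep) (f : rep_hom M M') (g : rep_hom N N').

Definition sum_hom_fun i (x : rep_sum M N i) : rep_sum M' N' i :=
  (f i x.1, g i x.2).

Fact sum_hom_linear i : linear (@sum_hom_fun i).
Proof. by move=> c x y; rewrite /sum_hom_fun /= !linearP. Qed.

HB.instance Definition _ i :=
  GRing.isLinear.Build k (rep_sum M N i) (rep_sum M' N' i) _
    (@sum_hom_fun i) (@sum_hom_linear i).

Fact sum_hom_arrow i (x : rep_sum M N i) :
  sum_hom_fun (arrow (rep_sum M N) i x) =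
  arrow (rep_sum M' N') i (sum_hom_fun x).
Proof. by rewrite /sum_hom_fun /= /sum_arrow_fun /= !hom_arrow. Qed.

Definition sum_hom : rep_hom (rep_sum M N) (rep_sum M' N') :=
  @Hom (rep_sum M N) (rep_sum M' N') (fun i => @sum_hom_fun i) sum_hom_arrow.

End SumHom.

Definition rep_iso (M N : rep) : Prop :=
  exists (f : rep_hom M N) (g : rep_hom N M),
    (forall i, cancel (f i) (g i)) /\ (forall i, cancel (g i) (f i)).

Definition is_zero_rep (M : rep) : Prop := forall i (x : M i), x = 0.

Definition indecomposable_rep (M : rep) : Prop :=
  ~ is_zero_rep M /\
  forall N P : rep, rep_iso M (rep_sum N P) -> is_zero_rep N \/ is_zero_rep P.

Definition injective_rep (M : rep) : Prop :=
  forall (X Y : rep) (f : rep_hom X Y) (g : rep_hom X M),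
    (forall i, injective (f i)) ->
    exists h : rep_hom Y M, forall i (x : X i), h i (f i x) = g i x.

(* The Jacobson radical of A_n is spanned by the arrows.  Hence soc M consists
   of the elements killed by the arrows, and rad M of the images of the
   arrows. *)
Definition in_soc (M : rep) i (x : M i) : Prop := arrow M i x = 0.

Variant in_rad (M : rep) : forall i, M i -> Prop :=
  InRad i (y : M i) : in_rad (arrow M i y).

Fact rad_sub_soc (M : rep) i (x : M i) : in_rad x -> in_soc x.
Proof. by case=> j y; exact: arrow_arrow. Qed.

(* soc M is a copy of the simple representation at j: it is zero at every
   other vertex, and a line at j. *)
Definition simple_socle_at (M : rep) (j : 'I_n) : Prop :=
  (forall i (x : M i), i != j -> in_soc x -> x = 0) /\
  exists2 s : M j, s != 0 &
    forall x : M j, in_soc x <-> exists c : k, x = c *: s.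

Definition indecomposable_injective_at (j : 'I_n) (M : rep) : Prop :=
  [/\ injective_rep M, indecomposable_rep M & simple_socle_at M j].

(* f is a composite M -> M / soc M ~ rad N -> N for some isomorphism in the
   middle: by the first isomorphism theorem these are the homomorphisms with
   kernel soc M and image rad N. *)
Definition top_to_radical (M N : rep) (f : rep_hom M N) : Prop :=
  (forall i (x : M i), f i x = 0 <-> in_soc x) /\
  (forall i (y : N i), in_rad y <-> exists x : M i, f i x = y).

Fact zero_rep_injective : injective_rep zero_rep.
Proof.
move=> X Y f g _; exists (zero_hom Y zero_rep) => i x.
by rewrite [LHS]thinmx0 [RHS]thinmx0.
Qed.

Section Pairing.

Variables (X M N : rep).

Definition pair_fun (f : rep_hom X M) (g : rep_hom X N) i (x : X i) : rep_sum M N i :=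
  (f i x, g i x).

Fact pair_fun_linear f g i : linear (@pair_fun f g i).
Proof. by move=> c x y; rewrite /pair_fun !linearP. Qed.

HB.instance Definition _ f g i :=
  GRing.isLinear.Build k (X i) (rep_sum M N i) _
    (@pair_fun f g i) (@pair_fun_linear f g i).

Fact pair_fun_arrow f g i (x : X i) :
  pair_fun f g (arrow X i x) = arrow (rep_sum M N) i (pair_fun f g x).
Proof. by rewrite /pair_fun /= /sum_arrow_fun /= !hom_arrow. Qed.

Definition pair_hom (f : rep_hom X M) (g : rep_hom X N) : rep_hom X (rep_sum M N) :=
  @Hom X (rep_sum M N) (fun i => @pair_fun f g i) (@pair_fun_arrow f g).

Definition fst_hom : rep_hom (rep_sum M N) M :=
  @Hom (rep_sum M N) M
    (fun i => fst : {linear (M i * N i)%type -> M i}) (fun _ _ => erefl).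

Definition snd_hom : rep_hom (rep_sum M N) N :=
  @Hom (rep_sum M N) N
    (fun i => snd : {linear (M i * N i)%type -> N i}) (fun _ _ => erefl).

End Pairing.

Fact rep_sum_injective (M N : rep) :
  injective_rep M -> injective_rep N -> injective_rep (rep_sum M N).
Proof.
move=> injM injN X Y f g f_inj.
have [h1 h1f] := injM X Y f (comp_hom (fst_hom M N) g) f_inj.
have [h2 h2f] := injN X Y f (comp_hom (snd_hom M N) g) f_inj.
exists (pair_hom h1 h2) => i x; rewrite /= /pair_fun h1f h2f /=.
by case: (g i x).
Qed.

End Representations.

Section Complexes.

Variables (k : fieldType) (n : nat).

(* The differential is indexed by two degrees, and vanishes unless the second
   is the successor of the first; this makes the shift and the truncations
   definable without transporting along equalities of degrees. *)
Record cochain := Cochain {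
  term :> int -> rep k n;
  differential : forall i j, rep_hom (term i) (term j);
  diff_shape : forall i j, j != i + 1 ->
    forall v (x : term i v), differential i j v x = 0;
  diff_diff : forall i j l v (x : term i v),
    differential j l v (differential i j v x) = 0 }.

Record chain_map (X Y : cochain) := ChainMap {
  chain_hom :> forall i, rep_hom (X i) (Y i);
  chain_comm : forall i j v (x : X i v),
    chain_hom j v (differential X i j v x) = differential Y i j v (chain_hom i v x) }.

Fact chain_id_comm (X : cochain) i j v (x : X i v) :
  differential X i j v x = differential X i j v x.
Proof. by []. Qed.

Definition chain_id (X : cochain) : chain_map X X :=
  @ChainMap X X (fun i => id_hom (X i)) (@chain_id_comm X).

Fact chain_comp_comm (X Y Z : cochain) (g : chain_map Y Z) (f : chain_map X Y)
    i j v (x : X i v) :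
  g j v (f j v (differential X i j v x)) = differential Z i j v (g i v (f i v x)).
Proof. by rewrite !chain_comm. Qed.

Definition chain_comp (X Y Z : cochain) (g : chain_map Y Z)
    (f : chain_map X Y) : chain_map X Z :=
  @ChainMap X Z (fun i => comp_hom (g i) (f i)) (chain_comp_comm g f).

Fact chain_zero_comm (X Y : cochain) i j v (x : X i v) :
  0 = differential Y i j v 0.
Proof. by rewrite linear0. Qed.

Definition chain_zero (X Y : cochain) : chain_map X Y :=
  @ChainMap X Y (fun i => zero_hom (X i) (Y i)) (@chain_zero_comm X Y).

(* Only the components of the homotopy of degree -1 are used. *)
Definition homotopic (X Y : cochain) (f g : chain_map X Y) : Prop :=
  exists h : forall i j, rep_hom (X i) (Y j),
    forall i v (x : X i v),
      f i v x - g i v x =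
      differential Y (i - 1) i v (h i (i - 1) v x)
      + h (i + 1) i v (differential X i (i + 1) v x).

Section Sum.

Variables X Y : cochain.

Fact complex_sum_shape i j : j != i + 1 ->
  forall v (x : rep_sum (X i) (Y i) v),
    sum_hom (differential X i j) (differential Y i j) v x = 0.
Proof. by move=> ij v x; rewrite /= /sum_hom_fun !diff_shape. Qed.

Fact complex_sum_diff i j l v (x : rep_sum (X i) (Y i) v) :
  sum_hom (differential X j l) (differential Y j l) v
    (sum_hom (differential X i j) (differential Y i j) v x) = 0.
Proof. by rewrite /= /sum_hom_fun /= !diff_diff. Qed.

Definition complex_sum : cochain :=
  Cochain complex_sum_shape complex_sum_diff.

End Sum.

Section Shift.

Variables (X : cochain) (r : int).

Definition shift_diff i j : rep_hom (X (i + r)) (X (j + r)) :=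
  scale_hom ((-1) ^ r) (differential X (i + r) (j + r)).

Fact shift_shape i j : j != i + 1 ->
  forall v (x : X (i + r) v), shift_diff i j v x = 0.
Proof.
move=> ij v x; rewrite /= diff_shape ?scaler0 //.
by rewrite addrAC (inj_eq (addIr r)).
Qed.

Fact shift_diff_diff i j l v (x : X (i + r) v) :
  shift_diff j l v (shift_diff i j v x) = 0.
Proof. by rewrite /= linearZ /= diff_diff !scaler0. Qed.

Definition shift_complex : cochain := Cochain shift_shape shift_diff_diff.

End Shift.

Section Truncation.

Definition trunc_term (b : bool) (M : rep k n) : rep k n :=
  if b then M else zero_rep k n.

Definition trunc_hom (b c : bool) (M N : rep k n) (f : rep_hom M N) :
    rep_hom (trunc_term b M) (trunc_term c N) :=
  match b, c return rep_hom (trunc_term b M) (trunc_term c N) with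
  | true, true => f
  | b', c' => zero_hom (trunc_term b' M) (trunc_term c' N)
  end.

Variables (X : cochain) (P : pred int).

Fact trunc_shape i j : j != i + 1 ->
  forall v (x : trunc_term (P i) (X i) v),
    trunc_hom (P i) (P j) (differential X i j) v x = 0.
Proof.
by move=> ij v; case: (P i); case: (P j) => x //=; rewrite diff_shape.
Qed.

Fact trunc_diff i j l v (x : trunc_term (P i) (X i) v) :
  trunc_hom (P j) (P l) (differential X j l) v
    (trunc_hom (P i) (P j) (differential X i j) v x) = 0.
Proof.
move: x; case: (P i); case: (P j); case: (P l) => x //=;
  by rewrite ?linear0 ?diff_diff.
Qed.

Definition trunc_complex : cochain := Cochain trunc_shape trunc_diff.

End Truncation.

End Complexes.

Section HomotopyCategory.

Variables (k : fieldType) (n : nat).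

Record KInj := MkKInj {
  KInj_complex :> cochain k n;
  KInj_injective : forall i, injective_rep (KInj_complex i) }.

Definition K_iso (X Y : KInj) : Prop :=
  exists (f : chain_map X Y) (g : chain_map Y X),
    homotopic (chain_comp g f) (chain_id X) /\
    homotopic (chain_comp f g) (chain_id Y).

Definition K_zero (X : KInj) : Prop :=
  homotopic (chain_id X) (chain_zero X X).

Definition K_sum (X Y : KInj) : KInj :=
  @MkKInj (complex_sum X Y)
    (fun i => rep_sum_injective (@KInj_injective X i) (@KInj_injective Y i)).

Definition K_indecomposable (X : KInj) : Prop :=
  ~ K_zero X /\
  forall Y Z : KInj, K_iso X (K_sum Y Z) -> K_zero Y \/ K_zero Z.

Definition K_shift (X : KInj) (r : int) : KInj :=
  @MkKInj (shift_complex X r) (fun i => @KInj_injective X (i + r)).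

Fact trunc_injective (X : KInj) (P : pred int) i :
  injective_rep (trunc_complex X P i).
Proof.
by rewrite /= /trunc_term; case: (P i);
  [exact: KInj_injective | exact: zero_rep_injective].
Qed.

Definition K_trunc (X : KInj) (P : pred int) : KInj :=
  MkKInj (@trunc_injective X P).

End HomotopyCategory.

Section PeriodicComplex.

Variables (k : fieldType) (n : nat) (n_gt0 : (0 < n)%N).

Fact residue_subproof (j : int) : (`|(j %% n%:Z)%Z| < n)%N.
Proof.
have n_neq0 : n%:Z != 0 by rewrite eqz_nat -lt0n.
by rewrite -ltz_nat gez0_abs ?modz_ge0 // ltz_pmod.
Qed.

Definition residue (j : int) : 'I_n := Ordinal (residue_subproof j).

Fact residueS (j : int) : residue (j + 1) = ordS (residue j).
Proof.
have n_neq0 : n%:Z != 0 by rewrite eqz_nat -lt0n.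
apply/val_inj/eqP; rewrite /= -eqz_nat -modz_nat gez0_abs ?modz_ge0 //.
by rewrite intS gez0_abs ?modz_ge0 // modzDmr addrC.
Qed.

(* d j is the map d_(j+1) : I_(j+1) -> I_j. *)
Variables (I : 'I_n -> rep k n) (d : forall j, rep_hom (I (ordS j)) (I j)).
Hypothesis I_injective : forall j, indecomposable_injective_at j (I j).
Hypothesis d_composite : forall j, top_to_radical (d j).

(* The map d_i if j = i - 1, and zero otherwise. *)
Definition step_hom (i j : 'I_n) : rep_hom (I i) (I j) :=
  match @eqP _ (ordS j) i with
  | ReflectT e => ecast i (rep_hom (I i) (I j)) e (d j)
  | ReflectF _ => zero_hom (I i) (I j)
  end.

Lemma step_homE j : step_hom (ordS j) j = d j.
Proof.
by rewrite /step_hom; case: eqP => // e; rewrite (eq_axiomK e).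
Qed.

Fact step_step (i j l : 'I_n) v (x : I i v) :
  step_hom j l v (step_hom i j v x) = 0.
Proof.
case: (altP (ordS l =P j)) => [e|nlj]; last first.
  by rewrite {1}/step_hom; case: eqP => // e; rewrite e eqxx in nlj.
case: (altP (ordS j =P i)) => [e'|nji]; last first.
  rewrite {2}/step_hom; case: eqP => [e'|_] /=; last exact: linear0.
  by rewrite e' eqxx in nji.
subst i j; rewrite !step_homE.
apply/(d_composite l).1/rad_sub_soc/(d_composite (ordS l)).2.
by exists x.
Qed.

(* I_1 is in degree 0, hence I_(1-i) in degree i. *)
Definition periodic_term (i : int) : rep k n := I (residue (1 - i)).

Definition periodic_diff (i j : int) :
    rep_hom (periodic_term i) (periodic_term j) :=
  if j == i + 1 then step_hom (residue (1 - i)) (residue (1 - j))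
  else zero_hom (periodic_term i) (periodic_term j).

Fact periodic_shape i j : j != i + 1 ->
  forall v (x : periodic_term i v), periodic_diff i j v x = 0.
Proof. by rewrite /periodic_diff => /negPf ->. Qed.

Fact periodic_diff_diff i j l v (x : periodic_term i v) :
  periodic_diff j l v (periodic_diff i j v x) = 0.
Proof.
rewrite /periodic_diff; case: (l == j + 1); last by [].
case: (j == i + 1); last by rewrite linear0.
exact: step_step.
Qed.

Definition periodic_complex : cochain k n :=
  Cochain periodic_shape periodic_diff_diff.

Fact periodic_injective i : injective_rep (periodic_complex i).
Proof. by have [] := I_injective (residue (1 - i)). Qed.

Definition K_periodic : KInj k n := MkKInj periodic_injective.

Definition I_trunc (l m : \bar int) : KInj k n :=
  K_trunc K_periodic (fun i => (l <= i%:E <= m)%E).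

End PeriodicComplex.

(* The admissible bounds: l in Z or -oo, m in Z or +oo, and l <= m. *)
Definition trunc_bounds (l m : \bar int) : Prop :=
  [/\ l <> +oo%E, m <> -oo%E & (l <= m)%E].

(* Main.v *)
Require Import Defs.
From HB Require Import structures.
From mathcomp Require Import all_boot all_order all_algebra.
From mathcomp Require Import constructive_ereal.
From mathcomp Require Import boolp classical_sets zify ring.

Set Implicit Arguments.
Unset Strict Implicit.
Unset Printing Implicit Defensive.

Import Order.TTheory GRing.Theory Num.Theory.
Local Open Scope ring_scope.

(** Let s be a sequence of vertices such that s i is the successor of
    s (i + 1).  For a complex X of injective modules, write T i and A i for the
    spaces of X i at s (i + 1) and s i.  The arrows of X i and the differential
    of X form a zigzag of vector spaces

      ... <- T i -> A (i + 1) <- T (i + 1) -> A (i + 2) <- ...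

    An indecomposable injective module has length two and is also projective,
    with generator at s (i + 1) if its socle is at s i; so a chain map
    from a truncation J of the periodic complex to X is a family of elements
    of the spaces T i, and a chain map from X to J is a family of linear forms
    on the spaces A i, both compatible with the zigzag.  Thus J is a direct
    summand of X as soon as the corresponding interval representation is a
    direct summand of the zigzag (string_split).

    Which interval splits off is decided by linear algebra (zigzag_splitting).
    Take a cohomology class of the socle of X that is not zero.  The interval
    ends where a class is killed by the next step, and it begins where a class
    cannot be followed further backwards; the linear forms are found by
    extension from subspaces.  The only delicate case is that of a class which
    can be followed backwards by any finite number of steps: one has to follow
    it backwards coherently, and this is possible if no class that is killed
    by the next step has finite depth, because two preimages of a class differ
    by such a class.  Otherwise such a class of finite depth splits off a
    bounded interval.

    If the socle of X is acyclic, then X is contractible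
    (socle_acyclic_K_zero): a linear contraction of the socle extends to X
    because the terms are injective, and it deforms the identity into a map of
    square zero.  Hence an indecomposable object has a nonzero truncation as a
    direct summand, and is isomorphic to it (indecomposable_split).

    Conversely, homotopic endomorphisms of a truncation agree on its socle,
    which is a line in each degree of the interval.  An endomorphism acts there
    by the same scalar in all degrees.  If the truncation is a direct sum of Y
    and Z, one of the two projections therefore kills the socle; it then has
    square zero, and Y or Z vanishes (string_K_indecomposable).  Finally the
    degrees and vertices that carry the socle determine l - r, m - r and
    the residue of r modulo n, which gives the condition for two truncations
    to be isomorphic. *)

(** * Linear algebra in arbitrary dimension *)

Section LinearRelations.

Variable k : fieldType.

Definition subspace (V : lmodType k) (H : V -> Prop) : Prop :=
  H 0 /\ forall c u v, H u -> H v -> H (c *: u + v).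

Section Selection.

Variables V W : lmodType k.
Implicit Types R G : V * W -> Prop.

Definition linear_relation R : Prop := subspace (V := (V * W)%type) R.

Definition single_valued R : Prop := forall w, R (0, w) -> w = 0.

(** A relation is enlarged by the line through one of its points (v, w); this
    stays single-valued because v lies outside the previous domain. *)
Lemma extend_single_valued G v w :
    linear_relation G -> single_valued G -> (forall w', ~ G (v, w')) ->
  let G' p := exists c, G (p - c *: (v, w)) in
  linear_relation G' /\ single_valued G'.
Proof.
move=> [G0 Glin] Gsv vG /=; split.
  split; first by exists 0; rewrite scale0r subr0.
  move=> a p q [c Gp] [b Gq]; exists (a * c + b).
  have -> : a *: p + q - (a * c + b) *: (v, w)
      = a *: (p - c *: (v, w)) + (q - b *: (v, w)).
    by rewrite scalerBr scalerDl scalerA opprD addrACA.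
  exact: Glin.
move=> u [c Gu]; have [c0 | c_neq0] := eqVneq c 0.
  by apply: Gsv; move: Gu; rewrite c0 scale0r subr0.
case: (vG (w - c^-1 *: u)).
have := Glin (- c^-1) _ _ Gu G0; rewrite addr0.
congr (G _); congr pair => /=.
  by rewrite sub0r scalerN scaleNr opprK scalerA mulVf // scale1r.
by rewrite scalerBr !scaleNr scalerA mulVf // scale1r opprK addrC.
Qed.

(** Zorn's lemma: a linear relation contains the graph of a linear function on
    its domain, and this function can be prescribed on a smaller domain. *)
Lemma linear_selection R G0 :
    linear_relation R ->
    linear_relation G0 -> single_valued G0 -> (forall p, G0 p -> R p) ->
  exists G, [/\ linear_relation G, single_valued G, (forall p, G0 p -> G p),
    (forall p, G p -> R p) & (forall v w, R (v, w) -> exists w', G (v, w'))].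
Proof.
move=> [R0 Rlin] G0lin G0sv G0R.
pose good G := [/\ linear_relation G, single_valued G,
  (forall p, G0 p -> G p) & (forall p, G p -> R p)].
(* The empty relation is admitted so that the empty chain has an upper bound. *)
pose P (G : set (V * W)) := (forall p, ~ G p) \/ good G.
have chainP F : (F `<=` P)%classic -> total_on F subset ->
    P (\bigcup_(G in F) G)%classic.
  move=> FP Ftot.
  have [[G FG Ggood] | noG] := pselect (exists2 G, F G & good G); last first.
    left=> p [G FG Gp]; have [/(_ p) // | Ggood] := FP _ FG.
    by apply: noG; exists G.
  have goodF G' p : F G' -> G' p -> good G'.
    by move=> FG' G'p; have [/(_ p) | ] := FP _ FG'.
  right; split.
  - split; first by exists G => //; have [[]] := Ggood.
    move=> c p q [G1 F1 p1] [G2 F2 q2].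
    have [s12 | s21] := Ftot _ _ F1 F2.
      exists G2 => //; have [[_ lin2] _ _ _] := goodF _ _ F2 q2.
      exact: lin2 (s12 _ p1) q2.
    exists G1 => //; have [[_ lin1] _ _ _] := goodF _ _ F1 p1.
    exact: lin1 p1 (s21 _ q2).
  - by move=> w [G1 F1 p1]; have [_ sv1 _ _] := goodF _ _ F1 p1; exact: sv1.
  - by move=> p G0p; exists G => //; have [_ _ + _] := Ggood; exact.
  - by move=> p [G1 F1 p1]; have [_ _ _] := goodF _ _ F1 p1; exact.
have [G [PG maxG]] := Zorn_bigcup chainP.
have goodG : good G.
  case: PG => // G_empty; case: (maxG G0).
    split; first by move=> p /G_empty.
    by move=> /(_ _ G0lin.1)/G_empty.
  by right; split.
have [Glin Gsv G0G GR] := goodG; exists G; split=> // v w Rvw.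
apply: contrapT => vG.
have [G'lin G'sv] := @extend_single_valued G v w Glin Gsv
  (fun w' Gvw' => vG (ex_intro _ w' Gvw')).
set G' := (fun p => exists c, _) in G'lin G'sv.
have GG' p : G p -> G' p by move=> Gp; exists 0; rewrite scale0r subr0.
case: (maxG G').
  split; first exact: GG'.
  move=> /(_ (v, w)) vwG; case: vG; exists w; apply: vwG.
  by exists 1; rewrite scale1r subrr; exact: Glin.1.
right; split=> // [p /G0G/GG' // | p [c /GR Rp]].
by have := Rlin c _ _ Rvw Rp; rewrite addrC subrK.
Qed.

(** A maximal single-valued relation containing [G] has full domain, since the
    relation that holds everywhere has. *)
Lemma linear_extension G :
    linear_relation G -> single_valued G ->
  exists f : {linear V -> W}, forall v w, G (v, w) -> f v = w.
Proof.
move=> Glin0 Gsv0.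
have Tlin : linear_relation (fun=> True) by [].
have [F [[F0 Flin] Fsv GF _ Ftot]] :=
  linear_selection Tlin Glin0 Gsv0 (fun _ _ => I).
have [f Ff] := choice (fun v => Ftot v 0 I).
have F_inj v w w' : F (v, w) -> F (v, w') -> w = w'.
  move=> Fw Fw'; apply/eqP; rewrite -subr_eq0; apply/eqP/Fsv.
  by have := Flin (-1) _ _ Fw' Fw; rewrite !scaleN1r addrC
    /GRing.add /= /add_pair /= subrr.
have f_lin : linear f.
  by move=> c u v; apply: F_inj (Ff _) _; exact: (Flin c _ _ (Ff u) (Ff v)).
pose fL : {linear V -> W} := HB.pack f (GRing.isLinear.Build k V W _ f f_lin).
by exists fL => v w /GF; apply: F_inj (Ff v).
Qed.

End Selection.

(** This is how linear forms are propagated along a zigzag, from a space T to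
    the neighbouring space A. *)
Lemma functional_extension (T A : lmodType k) (a : {linear T -> A})
    (g : {linear T -> k^o}) (H : A -> Prop) :
    subspace H -> (forall z, H (a z) -> g z = 0) ->
  exists f : {linear A -> k^o},
    (forall z, f (a z) = g z) /\ (forall x, H x -> f x = 0).
Proof.
move=> [H0 Hlin] gH.
pose G (p : A * k^o) := exists z x, [/\ H x, p.1 = a z + x & p.2 = g z].
have [|w [z [x [Hx /= az ->]]]|f fG] := @linear_extension A k^o G.
- split; first by exists 0, 0; rewrite !linear0 addr0.
  move=> c [p1 p2] [q1 q2] [z [x [Hx /= -> ->]]] [z' [x' [Hx' /= -> ->]]].
  exists (c *: z + z'), (c *: x + x'); split; first exact: Hlin.
    transitivity (c *: (a z + x) + (a z' + x')) => //.
    by rewrite linearP scalerDr addrACA.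
  by rewrite linearP.
- apply: gH; have := Hlin (-1) _ _ Hx H0.
  by rewrite addr0 scaleN1r; move/esym/eqP: az; rewrite addr_eq0 => /eqP->.
exists f; split=> [z | x Hx].
  by apply: fG; exists z, 0; rewrite addr0.
by apply: fG; exists 0, x; rewrite !linear0 add0r.
Qed.

Lemma separating_functional (A : lmodType k) (x : A) (H : A -> Prop) :
    subspace H -> ~ H x ->
  exists f : {linear A -> k^o}, f x = 1 /\ forall y, H y -> f y = 0.
Proof.
move=> Hsub Hx.
have line_lin : linear (fun c : k^o => c *: x).
  by move=> c u v; rewrite scalerDl scalerA.
pose line : {linear k^o -> A} :=
  HB.pack (fun c : k^o => c *: x) (GRing.isLinear.Build k k^o A _ _ line_lin).
have [|f [fx fH]] := @functional_extension k^o A line idfun H Hsub.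
  move=> c /= Hc; apply/eqP; apply: contrapT => /negP c0; apply: Hx.
  have := Hsub.2 c^-1 _ _ Hc Hsub.1.
  by rewrite addr0 scalerA mulVf // scale1r.
by exists f; split=> //; have := fx 1; rewrite /= scale1r.
Qed.

Lemma subspace_eq0 (V W : lmodType k) (f : {linear V -> W}) :
  subspace (fun x => f x = 0).
Proof.
split; first exact: linear0.
by move=> c u v fu fv; rewrite linearP fu fv scaler0 addr0.
Qed.

End LinearRelations.

(** * Sequences indexed by the integers *)

(** A sequence is prolonged step by step at either end, starting from its value
    at [i0]; [f0] gives it default values where it is not yet chosen. *)
Lemma int_dependent_choice (T : int -> Type) (Q : forall i, T i -> Prop)
    (R : forall i, T i -> T (i + 1) -> Prop)
    (f0 : forall i, T i) (i0 : int) (y0 : T i0) :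
    Q i0 y0 ->
    (forall i y, i0 <= i -> Q i y -> exists y', Q (i + 1) y' /\ R i y y') ->
    (forall i y, i < i0 -> Q (i + 1) y -> exists y', Q i y' /\ R i y' y) ->
  exists f : forall i, T i,
    [/\ f i0 = y0, forall i, Q i (f i) & forall i, R i (f i) (f (i + 1))].
Proof.
move=> Qy0 up down.
pose inside (N : nat) (i : int) := i0 - N%:Z <= i <= i0 + N%:Z.
pose good N f := [/\ f i0 = y0, forall i, inside N i -> Q i (f i)
  & forall i, inside N i -> inside N (i + 1) -> R i (f i) (f (i + 1))].
have start : good 0%N (dfwith f0 y0).
  split; first exact: dfwith_in.
    move=> i; rewrite /inside => ii0; have e : i = i0 by lia.
    by subst i; rewrite dfwith_in.
  by rewrite /inside => i; lia.
have step N f : good N f ->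
    exists f', good N.+1 f' /\ forall i, inside N i -> f' i = f i.
  move=> [fi0 Qf Rf].
  have [||y1 [Qy1 Ry1]] := up (i0 + N%:Z) (f (i0 + N%:Z)); first lia.
    by apply: Qf; rewrite /inside; lia.
  have [||y2 [Qy2 Ry2]] := down (i0 - N%:Z - 1) (f (i0 - N%:Z - 1 + 1)); first lia.
    by apply: Qf; rewrite /inside; lia.
  pose f' := dfwith (dfwith f y1) y2.
  have f'1 : f' (i0 + N%:Z + 1) = y1.
    by rewrite /f' dfwith_out ?dfwith_in //; lia.
  have f'2 : f' (i0 - N%:Z - 1) = y2 by rewrite /f' dfwith_in.
  have f'f i : inside N i -> f' i = f i.
    by rewrite /inside => Ni; rewrite /f' !dfwith_out //; lia.
  exists f'; split=> //; split.
  - by rewrite f'f // /inside; lia.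
  - move=> i Ni; have [iN | iN] := boolP (inside N i).
      by rewrite f'f //; exact: Qf.
    have [e | e] : i = i0 + N%:Z + 1 \/ i = i0 - N%:Z - 1.
      by move: Ni iN; rewrite /inside; lia.
    + by subst i; rewrite f'1.
    + by subst i; rewrite f'2.
  - move=> i Ni Ni1.
    have [/andP[iN iN1] | iN] := boolP (inside N i && inside N (i + 1)).
      by rewrite !f'f //; exact: Rf.
    have [e | e] : i = i0 + N%:Z \/ i = i0 - N%:Z - 1.
      by move: Ni Ni1 iN; rewrite /inside; lia.
    + by subst i; rewrite f'1 f'f // /inside; lia.
    + by subst i; rewrite f'2 f'f // /inside; lia.
pose g := fix g N : {f | good N f} := match N with
  | 0%N => exist _ _ start
  | N'.+1 => let: exist f fN := g N' in
      let: exist f' f'P := cid (step N' f fN) in exist _ f' f'P.1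
  end.
have gS N i : inside N i -> sval (g N.+1) i = sval (g N) i.
  move=> Ni /=; case: (g N) => f fN /=.
  by case: (cid _) => f' [? /= ->].
have gD N M i : inside N i -> sval (g (N + M)%N) i = sval (g N) i.
  move=> Ni; elim: M => [|M IH]; first by rewrite addn0.
  by rewrite addnS gS // /inside; move: Ni; rewrite /inside; lia.
pose w i := `|i - i0|%N.
have wE i : inside (w i) i by rewrite /inside /w; lia.
exists (fun i => sval (g (w i)) i); split.
- by rewrite /w subrr /= dfwith_in.
- by move=> i; have [_ + _] := svalP (g (w i)); apply.
move=> i; set N := maxn (w i) (w (i + 1)).
have iN : (w i <= N)%N by rewrite leq_maxl.
have i1N : (w (i + 1)%R <= N)%N by rewrite leq_maxr.
have <- : sval (g N) i = sval (g (w i)) i.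
  by rewrite -(subnKC iN) gD.
have <- : sval (g N) (i + 1) = sval (g (w (i + 1))) (i + 1).
  by rewrite -(subnKC i1N) gD.
have [_ _] := svalP (g N); apply; rewrite /inside /N /w; lia.
Qed.

(** * Interval summands of a zigzag of vector spaces *)

Definition in_interval (L M : \bar int) (j : int) : bool := (L <= j%:E <= M)%E.

Lemma in_interval_convex (L M : \bar int) i j l :
  i <= j <= l -> in_interval L M i -> in_interval L M l -> in_interval L M j.
Proof.
move=> /andP[ij jl] /andP[Li _] /andP[_ lM].
by rewrite /in_interval (le_trans Li) ?(le_trans _ lM) // lee_fin.
Qed.

Lemma interval_constant (X : Type) (P : pred int) (c : int -> X) :
    (forall i j l, i <= j <= l -> P i -> P l -> P j) ->
    (forall j, P j -> P (j + 1) -> c (j + 1) = c j) ->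
  forall i j, P i -> P j -> c i = c j.
Proof.
move=> convex cS; suff up i N : P i -> P (i + N%:Z) -> c (i + N%:Z) = c i.
  move=> i j Pi Pj; have [ij | /ltW ji] := lerP i j.
    have e : j = i + `|j - i|%N%:Z by lia.
    by rewrite e up // -e.
  have e : i = j + `|i - j|%N%:Z by lia.
  by rewrite e up // -e.
elim: N => [|N IH] Pi; first by rewrite addr0.
rewrite -addn1 PoszD addrA => PN.
have PN' : P (i + N%:Z) by apply: (convex i _ (i + N%:Z + 1)) => //; lia.
by rewrite cS // IH.
Qed.

Section Zigzag.

Variable k : fieldType.

(** The zigzag is ... A i <-al- T i (i + 1) -de-> A (i + 1) <-al- ....  The
    spaces T are indexed by pairs, used only at pairs (i, i + 1), so that no
    element has to be transported along an equality of degrees. *)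
Variables (T : int -> int -> lmodType k) (A : int -> lmodType k).
Variables (al : forall i j, {linear T i j -> A i}).
Variables (de : forall i j, {linear T i j -> A j}).

(** In the zigzag of a complex of injective modules the kernel of [al] is the
    socle, which consists of images of arrows; both hypotheses then follow from
    the vanishing of the square of the differential. *)
Hypothesis lift_boundary : forall i (z : T i (i + 1)), al i (i + 1) z = 0 ->
  exists w : T (i + 1) (i + 1 + 1), al _ _ w = de _ _ z /\ de _ _ w = 0.

Hypothesis lift_next :
  forall i (y : T i (i + 1)) (y' : T (i + 1) (i + 1 + 1)), al _ _ y' = de _ _ y ->
  exists y'' : T (i + 1 + 1) (i + 1 + 1 + 1), al _ _ y'' = de _ _ y'.

(** In the zigzag of a complex these are the coboundaries of the socle. *)
Definition boundary j (x : A j) : Prop :=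
  exists i (z : T i j), [/\ i + 1 = j, al i j z = 0 & de i j z = x].

(** The filtration of A j that decides where an interval begins. *)
Fixpoint reach (t : nat) j (x : A j) : Prop :=
  if t is t'.+1 then
    exists i (z : T i j), [/\ i + 1 = j, de i j z = x & reach t' (al i j z)]
  else True.

Definition deep j (x : A j) : Prop := forall t, reach t x.

Lemma boundary_subspace j : subspace (@boundary j).
Proof.
split; first by exists (j - 1), 0; rewrite subrK !linear0.
move=> c u v [i [z [ij az <-]]] [i' [z' [ij' az' <-]]].
have e : i' = i by lia.
subst i'; exists i, (c *: z + z').
by rewrite !linearP az az' scaler0 addr0.
Qed.

Lemma reach_subspace t j : subspace (@reach t j).
Proof.
elim: t j => [|t IH] j; first by [].
split.
  exists (j - 1), 0; rewrite subrK !linear0; split=> //; exact: (IH _).1.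
move=> c u v [i [z [ij <- rz]]] [i' [z' [ij' <- rz']]].
have e : i' = i by lia.
subst i'; exists i, (c *: z + z').
by rewrite !linearP; split=> //; exact: (IH _).2.
Qed.

Lemma boundary_deep j (x : A j) : boundary x -> deep x.
Proof.
move=> [i [z [ij az <-]]] [|t] //=; exists i, z; split=> //.
by rewrite az; exact: (reach_subspace _ _).1.
Qed.

(** The invariants that let a choice at the place [i] be continued downwards to
    [L].  A form on A (j + 1) that vanishes on [H] composes with [de] to a form
    on T j (j + 1) that vanishes on the preimage of [H], hence factors through
    A j as a form that again vanishes on [H].  Below [L] it is
    continued by 0, since [H] contains the image of [de] there. *)
Lemma pull_back (L : \bar int) i (y : T i (i + 1)) (f : {linear A i -> k^o})
    (G H : forall j, A j -> Prop) :
    (forall j, subspace (@H j)) ->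
    (forall j (z : T j (j + 1)), (L <= j%:E)%E -> H _ (al _ _ z) -> H _ (de _ _ z)) ->
    (forall j (z : T j (j + 1)), ~ (L <= j%:E)%E -> (L <= (j + 1)%:E)%E ->
      H _ (de _ _ z)) ->
    (forall j x, j < i -> (L <= j%:E)%E -> G (j + 1) x ->
      exists z : T j (j + 1), de _ _ z = x /\ G _ (al _ _ z)) ->
    G _ (al _ _ y) -> (forall x, H i x -> f x = 0) ->
  exists (ys : forall j, T j (j + 1)) (fs : forall j, {linear A j -> k^o}),
    [/\ ys i = y, fs i = f,
      forall j, j < i -> (L <= j%:E)%E -> de _ _ (ys j) = al _ _ (ys (j + 1)) &
      forall j, j < i -> (L <= (j + 1)%:E)%E -> forall x : T j (j + 1),
        fs (j + 1) (de _ _ x) = if (L <= j%:E)%E then fs j (al _ _ x) else 0].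
Proof.
move=> Hsub HalH Hde GG Gy fH.
have [|||ys [ysi _ yS]] := @int_dependent_choice (fun j => T j (j + 1))
  (fun j z => j <= i -> (L <= j%:E)%E -> G j (al _ _ z))
  (fun j z z' => j < i -> (L <= j%:E)%E -> de _ _ z = al _ _ z')
  (fun _ => 0) i y; first by [].
- by move=> j z ij _; exists 0; split=> [|ji]; lia.
- move=> j z ji Gz; have [Lj | Lj] := boolP (L <= j%:E)%E; last by exists 0.
  have L1 : (L <= (j + 1)%:E)%E by apply: le_trans Lj _; rewrite lee_fin; lia.
  have [|z' [dz' Gz']] := GG j (al _ _ z) ji Lj; first by apply: Gz => //; lia.
  by exists z'.
have [|||fs [fsi _ fS]] := @int_dependent_choice (fun j => {linear A j -> k^o})
  (fun j g => j <= i -> (L <= j%:E)%E -> forall x, H j x -> g x = 0)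
  (fun j g g' => j < i -> (L <= (j + 1)%:E)%E -> forall x : T j (j + 1),
     g' (de _ _ x) = if (L <= j%:E)%E then g (al _ _ x) else 0)
  (fun _ => \0) i f; first by [].
- by move=> j g ij _; exists \0; split=> [|ji]; lia.
- move=> j g ji gH; have [Lj | Lj] := boolP (L <= j%:E)%E; last first.
    exists \0; split=> // _ L1 x; apply: gH => //; first lia.
    by apply: Hde => //; exact/negP.
  have L1 : (L <= (j + 1)%:E)%E by apply: le_trans Lj _; rewrite lee_fin; lia.
  have [|g' [g'al g'H]] := @functional_extension _ _ _ (al j (j + 1))
    (g \o de j (j + 1)) (@H j) (Hsub j).
    by move=> z Hz /=; apply: gH => //; [lia | exact: HalH].
  by exists g'; split=> // _ _ x; rewrite Lj g'al.
by exists ys, fs; split.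
Qed.

(** For an element of finite depth t, the form has to vanish on the elements of
    depth t + 1, and the interval begins t steps below i.  In the second case
    the interval has no lower end; a preimage of an element of infinite depth
    has infinite depth, because it differs from preimages of arbitrary finite
    depth by elements of the kernel of [de]. *)
Lemma lower_part i (y : T i (i + 1)) :
    ~ boundary (al _ _ y) ->
    (exists t, reach t (al _ _ y) /\ ~ reach t.+1 (al _ _ y))
    \/ (deep (al _ _ y) /\
        forall j (z : T j (j + 1)), de _ _ z = 0 -> deep (al _ _ z)) ->
  exists (L : \bar int) (ys : forall j, T j (j + 1))
      (fs : forall j, {linear A j -> k^o}),
    [/\ L <> +oo%E, (L <= i%:E)%E, ys i = y, fs i (al _ _ y) = 1 &
      forall x, boundary x -> fs i x = 0] /\
    (forall j, j < i -> (L <= j%:E)%E -> de _ _ (ys j) = al _ _ (ys (j + 1))) /\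
    (forall j, j < i -> (L <= (j + 1)%:E)%E -> forall x : T j (j + 1),
        fs (j + 1) (de _ _ x) = if (L <= j%:E)%E then fs j (al _ _ x) else 0).
Proof.
move=> yB [[t [ty t1y]] | [y_deep ker_deep]].
  have [f [fy fH]] := separating_functional (reach_subspace t.+1 i) t1y.
  pose l := i - t%:Z.
  have [||||||ys [fs [ysi fsi yS fS]]] := @pull_back l%:E i y f
      (fun j => @reach (absz (j - l)%R) j) (fun j => @reach (absz (j - l)%R).+1 j).
  - by move=> j; exact: reach_subspace.
  - move=> j z; rewrite lee_fin => lj Hz.
    have -> : absz (j + 1 - l)%R = (absz (j - l)%R).+1 by lia.
    by exists j, z.
  - move=> j z; rewrite !lee_fin => lj lj1; have -> : (absz (j + 1 - l)%R) = 0%N by lia.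
    by exists j, z.
  - move=> j x ji; rewrite lee_fin => lj.
    have -> : (absz (j + 1 - l)%R) = (absz (j - l)%R).+1 by lia.
    move=> [j' [z [j'j <- rz]]]; have e : j' = j by lia.
    by subst j'; exists z.
  - by have -> : (absz (i - l)%R) = t by rewrite /l; lia.
  - have -> : (absz (i - l)%R).+1 = t.+1 by rewrite /l; lia.
    exact: fH.
  exists l%:E, ys, fs; split=> //; split=> //; rewrite ?fsi //.
    by rewrite lee_fin /l; lia.
  by move=> x /boundary_deep/(_ t.+1); exact: fH.
have [f [fy fH]] := separating_functional (boundary_subspace i) yB.
have [||||||ys [fs [ysi fsi yS fS]]] := @pull_back -oo%E i y f
    (fun j => @deep j) (fun j => @boundary j) => //.
- exact: boundary_subspace.
- move=> j z _ [j' [z' [j'j az' dz']]].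
  subst j; have [w [aw dw]] := lift_boundary az'.
  exists (j' + 1), (z - w); split=> //; rewrite linearB.
    by rewrite aw dz' subrr.
  by rewrite dw subr0.
- by move=> j z; rewrite leNye.
- move=> j x ji _ x_deep; have [j' [z [j'j dz _]]] := x_deep 1%N.
  have e : j' = j by lia.
  subst j'; exists z; split=> // t.
  have [j' [z' [j'j' dz' rz']]] := x_deep t.+1.
  have e : j' = j by lia.
  subst j'; have /ker_deep/(_ t) : de _ _ (z - z') = 0 by rewrite linearB dz dz' subrr.
  move=> rd; have := (reach_subspace t j).2 1 _ _ rd rz'.
  by rewrite scale1r -linearD subrK.
by exists -oo%E, ys, fs; split; [split; rewrite ?fsi // leNye | ].
Qed.

(** If [de] kills [y], the interval ends at i.  In the other case it has no
    upper end: a form that vanishes on [boundary] vanishes on the image under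
    [al] of the kernel of [de], so that it factors through [de]. *)
Lemma upper_part i (y : T i (i + 1)) (f : {linear A i -> k^o}) :
    (forall x, boundary x -> f x = 0) ->
    de _ _ y = 0
    \/ ((exists y' : T (i + 1) (i + 1 + 1), al _ _ y' = de _ _ y) /\
        forall j (z : T j (j + 1)), de _ _ z = 0 -> boundary (al _ _ z)) ->
  exists (M : \bar int) (ys : forall j, T j (j + 1))
      (fs : forall j, {linear A j -> k^o}),
    [/\ M <> -oo%E, (i%:E <= M)%E, ys i = y & fs i = f] /\
    (forall j, i <= j -> (j%:E <= M)%E ->
      de _ _ (ys j) = if ((j + 1)%:E <= M)%E then al _ _ (ys (j + 1)) else 0) /\
    (forall j, i <= j -> ((j + 1)%:E <= M)%E -> forall x : T j (j + 1),
        fs (j + 1) (de _ _ x) = fs j (al _ _ x)).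
Proof.
move=> fB [dy0 | [y_next ker_boundary]].
  exists i%:E, (@dfwith _ (fun j => T j (j + 1) : Type) (fun _ => 0) i y),
    (@dfwith _ (fun j => {linear A j -> k^o} : Type) (fun _ => \0) i f).
  split; [|split] => [|j ij|j ij]; rewrite ?dfwith_in ?lee_fin //; try lia.
  move=> ji; have e : j = i by lia.
  by subst j; rewrite dfwith_in dy0 ifF //; lia.
have [|||ys [ysi _ yS]] := @int_dependent_choice (fun j => T j (j + 1))
  (fun j z => i <= j ->
     exists z' : T (j + 1) (j + 1 + 1), al _ _ z' = de _ _ z)
  (fun j z z' => i <= j -> de _ _ z = al _ _ z')
  (fun _ => 0) i y; first by [].
- move=> j z ij /(_ ij) [z' az']; exists z'; split=> // _.
  exact: lift_next az'.
- by move=> j z ji _; exists 0; split=> ij; lia.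
have [|||fs [fsi _ fS]] := @int_dependent_choice (fun j => {linear A j -> k^o})
  (fun j g => i <= j -> forall x, boundary x -> g x = 0)
  (fun j g g' => i <= j -> forall x : T j (j + 1), g' (de _ _ x) = g (al _ _ x))
  (fun _ => \0) i f; first by [].
- move=> j g ij /(_ ij) gB.
  have [||g' [g'de _]] := @functional_extension _ _ _ (de j (j + 1))
    (g \o al j (j + 1)) (fun x => x = 0).
  + exact: (subspace_eq0 (idfun : {linear A (j + 1) -> A (j + 1)})).
  + by move=> z /ker_boundary/gB.
  exists g'; split=> // _ x [j' [z [j'j az <-]]].
  have e : j' = j by lia.
  by subst j'; rewrite g'de /= az linear0.
- by move=> j g ji _; exists \0; split=> ij; lia.
exists +oo%E, ys, fs; split; [by split; rewrite ?leey | split] => j ij _.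
  by rewrite leey; exact: yS.
exact: fS.
Qed.

(** [ys] is an embedding of an interval representation into the zigzag, and
    [fs] a retraction of the zigzag onto it. *)
Definition splitting (P : pred int) (ys : forall j, T j (j + 1))
    (fs : forall j, {linear A j -> k^o}) : Prop :=
  [/\ forall j, P j ->
        de _ _ (ys j) = if P (j + 1) then al _ _ (ys (j + 1)) else 0,
      forall j, P (j + 1) -> forall x : T j (j + 1),
        fs (j + 1) (de _ _ x) = if P j then fs j (al _ _ x) else 0 &
      forall j, P j -> fs j (al _ _ (ys j)) = 1].

Lemma glue_splitting L M i (yd yu : forall j, T j (j + 1))
    (fd fu : forall j, {linear A j -> k^o}) :
    (L <= i%:E)%E -> (i%:E <= M)%E ->
    yu i = yd i -> fu i = fd i -> fd i (al _ _ (yd i)) = 1 ->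
    (forall j, j < i -> (L <= j%:E)%E -> de _ _ (yd j) = al _ _ (yd (j + 1))) ->
    (forall j, j < i -> (L <= (j + 1)%:E)%E -> forall x : T j (j + 1),
      fd (j + 1) (de _ _ x) = if (L <= j%:E)%E then fd j (al _ _ x) else 0) ->
    (forall j, i <= j -> (j%:E <= M)%E ->
      de _ _ (yu j) = if ((j + 1)%:E <= M)%E then al _ _ (yu (j + 1)) else 0) ->
    (forall j, i <= j -> ((j + 1)%:E <= M)%E -> forall x : T j (j + 1),
      fu (j + 1) (de _ _ x) = fu j (al _ _ x)) ->
  splitting (in_interval L M) (fun j => if j <= i then yd j else yu j)
    (fun j => if j <= i then fd j else fu j).
Proof.
move=> Li iM yi fi fyi ydS fdS yuS fuS.
set ys := fun j => if j <= i then yd j else yu j.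
set fs := fun j => if j <= i then fd j else fu j.
have yu_ge j : i <= j -> ys j = yu j.
  rewrite /ys; case: ifP => // ji ij; have -> : j = i by lia.
  by rewrite yi.
have fu_ge j : i <= j -> fs j = fu j.
  rewrite /fs; case: ifP => // ji ij; have -> : j = i by lia.
  by rewrite fi.
have yd_le j : j <= i -> ys j = yd j by rewrite /ys => ->.
have fd_le j : j <= i -> fs j = fd j by rewrite /fs => ->.
have le_M j : j <= i -> (j%:E <= M)%E.
  by move=> ji; apply: le_trans iM; rewrite lee_fin.
have ge_L j : i <= j -> (L <= j%:E)%E.
  by move=> ij; apply: le_trans Li _; rewrite lee_fin.
have ysS j : in_interval L M j ->
    de _ _ (ys j) = if in_interval L M (j + 1) then al _ _ (ys (j + 1)) else 0.
  rewrite /in_interval => /andP[Lj jM]; have [ij | ji] := lerP i j.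
    by rewrite !yu_ge ?yuS ?ge_L //; lia.
  rewrite !yd_le ?le_M ?andbT ?ydS //; try lia.
  by rewrite ifT //; apply: le_trans Lj _; rewrite lee_fin; lia.
have fsS j : in_interval L M (j + 1) -> forall x : T j (j + 1),
    fs (j + 1) (de _ _ x) = if in_interval L M j then fs j (al _ _ x) else 0.
  rewrite /in_interval => /andP[Lj jM] x; have [ij | ji] := lerP i j.
    rewrite !fu_ge ?fuS ?ge_L //; try lia.
    by rewrite ifT //; apply: le_trans jM; rewrite lee_fin; lia.
  by rewrite !fd_le ?le_M ?andbT ?fdS //; lia.
split=> // j Pj.
have Pi : in_interval L M i by rewrite /in_interval Li iM.
rewrite -fyi -(yd_le i) // -(fd_le i) //.
apply: (@interval_constant _ (in_interval L M)
  (fun j => fs j (al _ _ (ys j)))) => //; first exact: in_interval_convex.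
move=> b Pb Pb1.
have := ysS b Pb; rewrite Pb1 => <-.
by rewrite fsS // Pb.
Qed.

(** Among the elements that [al] maps outside [boundary], the starting element
    is taken in a class C: those killed by [de], if there are any, and otherwise
    those that can be followed forwards.  In both cases C determines the upper
    end.  If C has an element of finite depth, it gives the lower end; if not, the kernel of [de]
    has only elements of infinite depth, and there is no lower end. *)
Lemma zigzag_splitting i (y : T i (i + 1)) (y' : T (i + 1) (i + 1 + 1)) :
    al _ _ y' = de _ _ y -> ~ boundary (al _ _ y) ->
  exists L M ys fs j, [/\ L <> +oo%E, M <> -oo%E, in_interval L M j &
    splitting (in_interval L M) ys fs].
Proof.
move=> y_next yB.
pose ker_class j (z : T j (j + 1)) := de _ _ z = 0 /\ ~ boundary (al _ _ z).
pose next_class j (z : T j (j + 1)) :=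
  (exists z' : T (j + 1) (j + 1 + 1), al _ _ z' = de _ _ z)
  /\ ~ boundary (al _ _ z).
have [C [[j [z Cz]] CB C_deep upper]] : exists C : forall j, T j (j + 1) -> Prop,
    [/\ exists j z, C j z, forall j z, C j z -> ~ boundary (al _ _ z),
      (forall j z, C j z -> deep (al _ _ z)) ->
        forall j (z : T j (j + 1)), de _ _ z = 0 -> deep (al _ _ z) &
      forall j z, C j z -> de _ _ z = 0
        \/ ((exists z' : T (j + 1) (j + 1 + 1), al _ _ z' = de _ _ z) /\
            forall j (z : T j (j + 1)), de _ _ z = 0 -> boundary (al _ _ z))].
  have [[j [z Kz]] | noK] := pselect (exists j z, ker_class j z).
    exists ker_class; split; first by exists j, z.
    - by move=> ? ? [].
    - move=> K_deep l w dw; have [wB | wB] := pselect (boundary (al _ _ w)).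
        exact: boundary_deep.
      exact: K_deep.
    - by move=> l w [dw _]; left.
  have ker_boundary l (w : T l (l + 1)) : de _ _ w = 0 -> boundary (al _ _ w).
    by move=> dw; apply: contrapT => wB; apply: noK; exists l, w.
  exists next_class; split; first by exists i, y; split=> //; exists y'.
  - by move=> ? ? [].
  - by move=> _ l w /ker_boundary/boundary_deep.
  - by move=> l w [w' _]; right.
have finish l w : C l w ->
    (exists t, reach t (al _ _ w) /\ ~ reach t.+1 (al _ _ w))
    \/ (deep (al _ _ w) /\
        forall j (z : T j (j + 1)), de _ _ z = 0 -> deep (al _ _ z)) ->
    exists L M ys fs j, [/\ L <> +oo%E, M <> -oo%E, in_interval L M j &
      splitting (in_interval L M) ys fs].
  move=> Cw /(lower_part (CB _ _ Cw)).
  move=> [L [yd [fd [[L_fin Ll ydl fdl fdB] [ydS fdS]]]]].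
  have [M [yu [fu [[M_fin lM yul ful] [yuS fuS]]]]] :=
    upper_part fdB (upper _ _ Cw).
  exists L, M; do 2 eexists; exists l; split=> //; first by apply/andP.
  by apply: glue_splitting Ll lM _ ful _ ydS fdS yuS fuS; rewrite ydl.
have [[l [w [Cw [t tw]]]] | no_finite] :=
    pselect (exists l w, C l w /\ exists t, ~ reach t (al _ _ w)).
  apply: finish (Cw) _; left.
  have ex_t : exists t, `[< ~ reach t (al _ _ w) >] by exists t; apply/asboolP.
  case: (ex_minnP ex_t) => -[|s] /asboolP sw smin; first by case: sw.
  exists s; split=> //; apply: contrapT => sw'.
  by have := smin s; rewrite ltnn => /(_ (introT (asboolP _) sw')).
have all_deep l w : C l w -> deep (al _ _ w).
  move=> Cw t; apply: contrapT => tw; apply: no_finite.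
  by exists l, w; split=> //; exists t.
by apply: finish (Cz) _; right; split; [exact: all_deep | exact: C_deep].
Qed.

End Zigzag.

(** * Modules over the cyclic quiver *)

Section Arrows.

Variables (k : fieldType) (n : nat).
Implicit Types (M N : rep k n) (v w j : 'I_n).

(** The arrow from v to w, or 0 if there is none.  As with differentials, two
    indices avoid transport along equalities of vertices. *)
Definition arr M v w : {linear M v -> M w} :=
  match @eqP _ (ordS v) w with
  | ReflectT e => eq_rect _ (fun w => {linear M v -> M w}) (arrow M v) _ e
  | ReflectF _ => \0
  end.

(** The identity if v = w, and 0 otherwise; a map that involves only one vertex
    is then given by one formula at all vertices. *)
Definition same M v w : {linear M v -> M w} :=
  match @eqP _ v w with
  | ReflectT e => eq_rect _ (fun w => {linear M v -> M w}) idfun _ e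
  | ReflectF _ => \0
  end.

Lemma arrE M v : arr M v (ordS v) = arrow M v.
Proof. by rewrite /arr; case: eqP => // e; rewrite (eq_axiomK e). Qed.

Lemma arr_neq M v w (x : M v) : ordS v != w -> arr M v w x = 0.
Proof. by rewrite /arr; case: eqP. Qed.

Lemma sameE M v (x : M v) : same M v v x = x.
Proof. by rewrite /same; case: eqP => // e; rewrite (eq_axiomK e). Qed.

Lemma same_neq M v w (x : M v) : v != w -> same M v w x = 0.
Proof. by rewrite /same; case: eqP. Qed.

Lemma arr_arr M u v w (x : M u) : arr M v w (arr M u v x) = 0.
Proof.
have [e | /arr_neq ->] := eqVneq (ordS u) v; last exact: linear0.
have [e' | /arr_neq -> //] := eqVneq (ordS v) w.
by subst v w; rewrite !arrE arrow_arrow.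
Qed.

Lemma hom_arr M N (f : rep_hom M N) v w (x : M v) :
  f w (arr M v w x) = arr N v w (f v x).
Proof.
have [e | vw] := eqVneq (ordS v) w; last by rewrite !arr_neq // linear0.
by subst w; rewrite !arrE hom_arrow.
Qed.

Lemma arr_same M u v w (x : M u) : u = v -> arr M v w (same M u v x) = arr M u w x.
Proof. by move=> <-; rewrite sameE. Qed.

Lemma ordS_inj : injective (@ordS n).
Proof. exact: can_inj (@ordSK n). Qed.

Lemma in_soc_arr M v w (x : M v) : in_soc x -> arr M v w x = 0.
Proof.
move=> x_soc; have [e | /arr_neq -> //] := eqVneq (ordS v) w.
by subst w; rewrite arrE.
Qed.

Lemma arr_in_soc M v w (x : M v) : ordS v = w -> arr M v w x = 0 -> in_soc x.
Proof. by move=> <-; rewrite arrE. Qed.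

Lemma in_soc_of_arr M u v (x : M u) : in_soc (arr M u v x).
Proof. by apply: (@arr_in_soc _ _ (ordS v)) => //; exact: arr_arr. Qed.

Lemma hom_soc M N (f : rep_hom M N) v (x : M v) : in_soc x -> in_soc (f v x).
Proof. by rewrite /in_soc -hom_arrow => ->; exact: linear0. Qed.

Lemma soc_subspace M v : subspace (fun x : M v => in_soc x).
Proof. exact: subspace_eq0. Qed.

Lemma in_rad_arr M v w (x : M w) : ordS v = w -> in_rad x ->
  exists y, arr M v w y = x.
Proof.
move=> vw x_rad; case: x_rad vw => u y /ordS_inj uv.
by subst v; exists y; rewrite arrE.
Qed.

Lemma arr_in_rad M v w (x : M v) : ordS v = w -> in_rad (arr M v w x).
Proof. by move=> <-; rewrite arrE. Qed.

End Arrows.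

Section InjectiveModules.

Variables (k : fieldType) (n : nat).
Implicit Types M N : rep k n.

Lemma retract_injective M N (i : rep_hom N M) (r : rep_hom M N) :
  (forall v x, r v (i v x) = x) -> injective_rep M -> injective_rep N.
Proof.
move=> ri M_inj X Y f g f_inj.
have [h hf] := M_inj X Y f (comp_hom i g) f_inj.
by exists (comp_hom r h) => v x; rewrite /= hf /= ri.
Qed.

Let loop_arrow_fun (x : (k^o * k^o)%type) : (k^o * k^o)%type := (0, x.1).

Let loop_arrow_linear : linear loop_arrow_fun.
Proof.
by move=> c x y; congr pair; rewrite /= scaler0 addr0.
Qed.

(** In an injective module every element of the socle is an image of the
    arrow: the map from a simple module extends to the module of length two in
    which the simple one is the socle. *)
Lemma soc_in_image M v w (x : M w) :
  injective_rep M -> ordS v = w -> in_soc x -> exists y, arr M v w y = x.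
Proof.
move=> M_inj vw x_soc.
pose aL : {linear (k^o * k^o)%type -> (k^o * k^o)%type} :=
  HB.pack loop_arrow_fun (GRing.isLinear.Build k (k^o * k^o)%type
    (k^o * k^o)%type _ loop_arrow_fun loop_arrow_linear).
(* Direct sums of all modules of length two, and of their socles. *)
pose Y : rep k n := @Rep k n (fun=> (k^o * k^o)%type) (fun=> aL) (fun _ _ => erefl).
pose X : rep k n := @Rep k n (fun=> k^o) (fun=> \0) (fun _ _ => erefl).
have f_lin : linear (fun b : k^o => (0, b) : (k^o * k^o)%type).
  by move=> c a b; congr pair; rewrite /= scaler0 addr0.
pose fL : {linear k^o -> (k^o * k^o)%type} :=
  HB.pack (fun b : k^o => (0, b) : (k^o * k^o)%type)
    (GRing.isLinear.Build k k^o (k^o * k^o)%type _ _ f_lin).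
pose f : rep_hom X Y := @Defs.Hom k n X Y (fun=> fL) (fun _ _ => erefl).
have g_lin u : linear (fun b : k^o => b *: same M w u x).
  by move=> c a b; rewrite scalerDl scalerA.
pose gL u : {linear k^o -> M u} :=
  HB.pack (fun b : k^o => b *: same M w u x)
    (GRing.isLinear.Build k k^o (M u) _ _ (g_lin u)).
have g_arrow u (b : X u) : gL (ordS u) (arrow X u b) = arrow M u (gL u b).
  rewrite /= scale0r linearZ /=; have [e | /same_neq ->] := eqVneq w u.
    by subst u; rewrite sameE x_soc scaler0.
  by rewrite linear0 scaler0.
pose g : rep_hom X M := @Defs.Hom k n X M gL g_arrow.
have [|h hf] := M_inj X Y f g; first by move=> u a b [].
exists (h v (1, 0)); subst w.
by rewrite arrE -hom_arrow; have := hf (ordS v) 1; rewrite /= sameE scale1r.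
Qed.

End InjectiveModules.

Section StringModules.

Variables (k : fieldType) (n : nat).
Implicit Types M N : rep k n.

(** The module of length two with generator [e] and socle at j, together with
    a linear form that identifies the socle with the base field.  It is both
    projective and injective: [e] represents the maps out of it, and [eps] the
    maps into it.  For n = 1 the generator and the socle lie at the same vertex,
    and [eps] is normalized to vanish on the generator. *)
Record string_module M (v j : 'I_n) (e : M v) (eps : {linear M j -> k^o}) : Prop :=
  StringModule {
    string_ordS : ordS v = j;
    string_soc_neq : forall w (x : M w), w != j -> in_soc x -> x = 0;
    string_eps_soc : eps (arr M v j e) = 1;
    string_eps_gen : eps (same M v j e) = 0;
    string_soc : forall x : M j, in_soc x -> x = eps x *: arr M v j e }.

Lemma simple_socle_string M v j (e : M v) :
    ordS v = j -> simple_socle_at M j -> arr M v j e != 0 ->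
  exists eps : {linear M j -> k^o}, string_module e eps.
Proof.
move=> vj [soc_neq [s s0 socE]] ae0.
have [|c aeE] := (socE (arr M v j e)).1; first exact: in_soc_of_arr.
have c0 : c != 0 by apply: contraNneq ae0 => c0; rewrite aeE c0 scale0r.
have [||f [fe _]] := @separating_functional k (M j) (arr M v j e) (fun x => x = 0).
- exact: (subspace_eq0 (idfun : {linear M j -> M j})).
- exact/eqP.
(* The correction makes the form vanish on [e] in the case v = j; it does not
   change the values on the socle. *)
pose g : {linear M j -> k^o} := f \- (f (same M v j e) \*: (f \o arr M j j)).
have gE x : g x = f x - f (same M v j e) * f (arr M j j x) by [].
exists g; split=> //.
- by rewrite gE arr_arr linear0 mulr0 subr0.
- rewrite gE; have [e1 | /same_neq ->] := eqVneq v j; last first.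
    by rewrite !linear0 mulr0 subr0.
  by rewrite arr_same // fe mulr1 subrr.
move=> x x_soc; rewrite gE in_soc_arr // linear0 mulr0 subr0.
have [b xb] := (socE x).1 x_soc.
have -> : x = (b * c^-1) *: arr M v j e by rewrite aeE scalerA mulfVK.
by congr (_ *: _); rewrite linearZ /= fe; symmetry; exact: mulr1.
Qed.

Section StringMaps.

Variables (M : rep k n) (v j : 'I_n) (e : M v) (eps : {linear M j -> k^o}).
Hypothesis M_string : string_module e eps.

Lemma string_hom_from N (y : N v) : exists f : rep_hom M N, f v e = y.
Proof.
have [vj _ eps1 eps0 _] := M_string.
(* [eps] of [arr x] is the coefficient of [e] in x, and [eps x] that of the
   socle. *)
pose f w (x : M w) : N w := (eps (arr M w j x) : k) *: same N v w y
  + (eps (same M w j x) : k) *: same N j w (arr N v j y).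
have f_lin w : linear (f w).
  by move=> c x x'; rewrite /f (linearP (arr M w j)) (linearP (same M w j)) !(linearP eps)
    !scalerDl scalerDr !scalerA addrACA.
pose fL w : {linear M w -> N w} :=
  HB.pack (f w) (GRing.isLinear.Build k (M w) (N w) _ _ (f_lin w)).
have f_arrow w (x : M w) : fL (ordS w) (arrow M w x) = arrow N w (fL w x).
  rewrite -!arrE /= /f arr_arr linear0 scale0r add0r linearD !linearZ /=.
  have -> : arr N w (ordS w) (same N j w (arr N v j y)) = 0.
    have [jw | /same_neq ->] := eqVneq j w; last exact: linear0.
    by rewrite arr_same // arr_arr.
  rewrite scaler0 addr0; have [wj | wj] := eqVneq (ordS w) j.
    have vw : w = v by apply: ordS_inj; rewrite wj vj.
    by subst w j; rewrite !sameE.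
  by rewrite same_neq // linear0 scale0r arr_neq // linear0 scale0r.
exists (@Defs.Hom k n M N fL f_arrow); rewrite /= /f.
by rewrite eps1 eps0 scale1r scale0r addr0 sameE.
Qed.

Lemma string_hom_to N (phi : {linear N j -> k^o}) :
  exists g : rep_hom N M, forall x, eps (g j x) = phi x.
Proof.
have [vj _ eps1 eps0 _] := M_string.
pose g w (x : N w) : M w := (phi (arr N w j x) : k) *: same M v w e
  + (phi (same N w j x) : k) *: same M j w (arr M v j e).
have g_lin w : linear (g w).
  by move=> c x x'; rewrite /g (linearP (arr N w j)) (linearP (same N w j)) !(linearP phi)
    !scalerDl scalerDr !scalerA addrACA.
pose gL w : {linear N w -> M w} :=
  HB.pack (g w) (GRing.isLinear.Build k (N w) (M w) _ _ (g_lin w)).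
have g_arrow w (x : N w) : gL (ordS w) (arrow N w x) = arrow M w (gL w x).
  rewrite -!arrE /= /g arr_arr linear0 scale0r add0r linearD !linearZ /=.
  have -> : arr M w (ordS w) (same M j w (arr M v j e)) = 0.
    have [jw | /same_neq ->] := eqVneq j w; last exact: linear0.
    by rewrite arr_same // arr_arr.
  rewrite scaler0 addr0; have [wj | wj] := eqVneq (ordS w) j.
    have vw : w = v by apply: ordS_inj; rewrite wj vj.
    by subst w j; rewrite !sameE.
  by rewrite same_neq // linear0 scale0r arr_neq // linear0 scale0r.
exists (@Defs.Hom k n N M gL g_arrow) => x; rewrite /= /g !sameE linearD !linearZ /=.
by rewrite eps0 eps1 scaler0 add0r; exact: mulr1.
Qed.

Lemma string_hom_from_eq N (f g : rep_hom M N) :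
  f v e = g v e -> forall w x, f w x = g w x.
Proof.
have [vj soc_neq _ _ socE] := M_string.
move=> fge; have on_soc w (x : M w) : in_soc x -> f w x = g w x.
  have [wj | wj] := eqVneq w j => x_soc; last by rewrite (soc_neq w x) // !linear0.
  by subst w; rewrite (socE x) // !linearZ /= !hom_arr fge.
move=> w x; have ax_soc := in_soc_of_arr (ordS w) x.
have [wj | wj] := eqVneq (ordS w) j; last first.
  apply: on_soc; apply: (@arr_in_soc _ _ _ _ (ordS w)) => //.
  exact: soc_neq wj ax_soc.
have wv : w = v by apply: ordS_inj; rewrite wj vj.
subst w j; set c := eps (arr M v (ordS v) x).
have x_soc : in_soc (x - c *: e).
  apply: (@arr_in_soc _ _ _ _ (ordS v)) => //.
  by rewrite linearB linearZ /= {1}(socE _ ax_soc) subrr.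
by have := on_soc _ _ x_soc; rewrite !linearB !linearZ /= fge => /addIr.
Qed.

(** The difference of two such maps vanishes at every element with image in the
    socle, hence first on images of arrows, and then everywhere. *)
Lemma string_hom_to_eq N (f g : rep_hom N M) :
  (forall x, eps (f j x) = eps (g j x)) -> forall w x, f w x = g w x.
Proof.
have [_ soc_neq _ _ socE] := M_string.
move=> fg; pose h w (x : N w) := f w x - g w x.
have h_soc w (x : N w) : in_soc (h w x) -> h w x = 0.
  have [wj | wj] := eqVneq w j => hx; last exact: soc_neq wj hx.
  subst w; rewrite (socE _ hx) /h linearB /= fg subrr.
  exact: scale0r.
move=> w x; apply/eqP; rewrite -subr_eq0; apply/eqP/h_soc.
rewrite /in_soc linearB /= -!hom_arrow; apply: h_soc.
by rewrite /in_soc linearB /= -!hom_arrow !arrow_arrow !linear0 addr0.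
Qed.

End StringMaps.

End StringModules.

Section Subrepresentations.

Variable k : fieldType.

Record subspace_of (V : lmodType k) := SubspaceOf {
  subspace_pred :> V -> Prop;
  subspace_ofP : subspace subspace_pred }.

Definition subspace_mem (V : lmodType k) (U : subspace_of V) : {pred V} :=
  fun x => `[< U x >].

Fact subspace_mem_closed (V : lmodType k) (U : subspace_of V) :
  submod_closed (subspace_mem U).
Proof.
have [U0 Ulin] := subspace_ofP U; split; first exact/asboolP.
by move=> c u v /asboolP Uu /asboolP Uv; apply/asboolP/Ulin.
Qed.

HB.instance Definition _ (V : lmodType k) (U : subspace_of V) :=
  GRing.isSubmodClosed.Build k V (subspace_mem U) (subspace_mem_closed U).

Definition subspace_type (V : lmodType k) (U : subspace_of V) : Type :=
  {x | x \in subspace_mem U}.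

HB.instance Definition _ (V : lmodType k) (U : subspace_of V) :=
  SubType.on (subspace_type U).
HB.instance Definition _ (V : lmodType k) (U : subspace_of V) :=
  [Choice of subspace_type U by <:].
HB.instance Definition _ (V : lmodType k) (U : subspace_of V) :=
  [SubChoice_isSubLmodule of subspace_type U by <:].

Section Corestriction.

Variables (V W : lmodType k) (U : subspace_of W) (f : {linear V -> W}).
Hypothesis fU : forall x, U (f x).

Definition corestrict (x : V) : subspace_type U := exist _ (f x) (asboolT (fU x)).

Lemma corestrict_linear : linear corestrict.
Proof. by move=> c x y; apply: val_inj; rewrite /= linearP. Qed.

HB.instance Definition _ :=
  GRing.isLinear.Build k V (subspace_type U) _ corestrict corestrict_linear.

End Corestriction.

Lemma subspace_typeP (V : lmodType k) (U : subspace_of V) (x : subspace_type U) :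
  U (val x).
Proof. by apply/asboolP; exact: (valP x). Qed.

Variable n : nat.

Section SubRep.

Variables (M : rep k n) (U : forall v, subspace_of (M v)).
Hypothesis U_arrow : forall v x, U v x -> U (ordS v) (arrow M v x).

Let sub_arrow_in v (x : subspace_type (U v)) : U (ordS v) ((arrow M v \o val) x).
Proof. exact/U_arrow/subspace_typeP. Qed.

Let sub_arrow v : {linear subspace_type (U v) -> subspace_type (U (ordS v))} :=
  corestrict (sub_arrow_in (v := v)).

Let sub_arrow_arrow v x : sub_arrow (ordS v) (sub_arrow v x) = 0.
Proof. by apply: val_inj; rewrite /= arrow_arrow. Qed.

Definition sub_rep : rep k n := Rep sub_arrow_arrow.

Definition sub_incl : rep_hom sub_rep M :=
  @Defs.Hom k n sub_rep M (fun v => (val : subspace_type (U v) -> M v))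
    (fun _ _ => erefl).

Lemma sub_incl_inj v : injective (sub_incl v).
Proof. exact: val_inj. Qed.

Lemma sub_inclP v (x : sub_rep v) : U v (sub_incl v x).
Proof. exact: subspace_typeP. Qed.

Lemma sub_corestrict N (f : rep_hom N M) : (forall v x, U v (f v x)) ->
  exists g : rep_hom N sub_rep, forall v x, sub_incl v (g v x) = f v x.
Proof.
move=> fU.
pose g v : {linear N v -> sub_rep v} := corestrict (fU v).
have g_arrow v (x : N v) : g (ordS v) (arrow N v x) = arrow sub_rep v (g v x).
  by apply: val_inj; rewrite /= hom_arrow.
by exists (@Defs.Hom k n N sub_rep g g_arrow).
Qed.

End SubRep.

(** On the socle, any family of linear maps commutes with the arrows, which
    vanish. *)
Lemma socle_extension (M N : rep k n) (s : forall v, {linear M v -> N v}) :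
    injective_rep N -> (forall v x, in_soc x -> in_soc (s v x)) ->
  exists h : rep_hom M N, forall v x, in_soc x -> h v x = s v x.
Proof.
move=> N_inj s_soc.
pose U v := SubspaceOf (soc_subspace M v).
have U_arrow v x : U v x -> U (ordS v) (arrow M v x).
  by move=> _; exact: arrow_arrow.
pose S := sub_rep U_arrow; pose i := sub_incl U_arrow.
have g_arrow v (x : S v) :
    (s (ordS v) \o i (ordS v)) (arrow S v x) = arrow N v ((s v \o i v) x).
  have x_soc : in_soc (i v x) by exact: (sub_inclP x).
  transitivity (s (ordS v) (arrow M v (i v x))); first by rewrite -hom_arrow.
  by rewrite x_soc linear0; exact/esym/s_soc.
pose g : rep_hom S N := @Defs.Hom k n S N (fun v => s v \o i v) g_arrow.
have [h hi] := N_inj S M i g (@sub_incl_inj _ _ U_arrow).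
exists h => v x x_soc.
exact: (hi v (exist _ x (asboolT x_soc))).
Qed.

End Subrepresentations.

(** * Homotopy *)

Section Homotopy.

Variables (k : fieldType) (n : nat).

Section Homs.

Variables M N : rep k n.

Fact add_hom_arrow (f g : rep_hom M N) v (x : M v) :
  (f (ordS v) \+ g (ordS v)) (arrow M v x) = arrow N v ((f v \+ g v) x).
Proof. by rewrite /= !hom_arrow linearD. Qed.

Definition add_hom (f g : rep_hom M N) : rep_hom M N :=
  @Defs.Hom k n M N (fun v => f v \+ g v) (add_hom_arrow f g).

Definition sub_hom (f g : rep_hom M N) : rep_hom M N := add_hom f (scale_hom (-1) g).

Lemma sub_homE f g v (x : M v) : sub_hom f g v x = f v x - g v x.
Proof. by rewrite /= scaleN1r. Qed.

End Homs.

Implicit Types X Y Z : cochain k n.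

Fact chain_sub_comm X Y (f g : chain_map X Y) i j v (x : X i v) :
  sub_hom (f j) (g j) v (differential X i j v x)
  = differential Y i j v (sub_hom (f i) (g i) v x).
Proof. by rewrite !sub_homE linearB !chain_comm. Qed.

Definition chain_sub X Y (f g : chain_map X Y) : chain_map X Y :=
  @ChainMap k n X Y (fun i => sub_hom (f i) (g i)) (chain_sub_comm f g).

Lemma homotopic_eq X Y (f g : chain_map X Y) :
  (forall i v x, f i v x = g i v x) -> homotopic f g.
Proof.
move=> fg; exists (fun i j => zero_hom _ _) => i v x.
by rewrite fg subrr /= linear0 addr0.
Qed.

Lemma homotopic_sym X Y (f g : chain_map X Y) : homotopic f g -> homotopic g f.
Proof.
move=> [h fg]; exists (fun i j => scale_hom (-1) (h i j)) => i v x.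
by rewrite -opprB fg /= !scaleN1r linearN opprD.
Qed.

Lemma homotopic_trans X Y (f g h : chain_map X Y) :
  homotopic f g -> homotopic g h -> homotopic f h.
Proof.
move=> [s fg] [t gh]; exists (fun i j => add_hom (s i j) (t i j)) => i v x.
by rewrite -(subrKA (g i v x)) fg gh /= linearD addrACA.
Qed.

Lemma homotopic_comp X Y X' Y' (a : chain_map Y Y') (b : chain_map X' X)
    (f g : chain_map X Y) :
  homotopic f g ->
  homotopic (chain_comp a (chain_comp f b)) (chain_comp a (chain_comp g b)).
Proof.
move=> [h fg]; exists (fun i j => comp_hom (a j) (comp_hom (h i j) (b i))) => i v x.
by rewrite /= -linearB fg linearD chain_comm chain_comm.
Qed.

Lemma homotopic_compl X Y Y' (a : chain_map Y Y') (f g : chain_map X Y) :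
  homotopic f g -> homotopic (chain_comp a f) (chain_comp a g).
Proof. exact: (homotopic_comp a (chain_id X)). Qed.

Lemma K_iso_sym (X Y : KInj k n) : K_iso X Y -> K_iso Y X.
Proof. by move=> [f [g [gf fg]]]; exists g, f. Qed.

Lemma K_iso_trans (X Y Z : KInj k n) : K_iso X Y -> K_iso Y Z -> K_iso X Z.
Proof.
move=> [f [g [gf fg]]] [f' [g' [gf' fg']]].
exists (chain_comp f' f), (chain_comp g g'); split.
  exact: homotopic_trans (homotopic_comp g f gf') gf.
exact: homotopic_trans (homotopic_comp f' g' fg) fg'.
Qed.

Lemma K_zero_retract (X Y : KInj k n) (a : chain_map X Y) (b : chain_map Y X) :
  homotopic (chain_comp a b) (chain_id Y) -> K_zero X -> K_zero Y.
Proof.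
move=> ab X0; apply: homotopic_trans (homotopic_sym ab) _.
apply: homotopic_trans (homotopic_comp a b X0) _.
by apply: homotopic_eq => i v x; exact: linear0.
Qed.

Lemma K_indecomposable_iso (X Y : KInj k n) :
  K_iso X Y -> K_indecomposable X -> K_indecomposable Y.
Proof.
move=> XY [X_neq0 X_indec]; split.
  move=> Y0; apply: X_neq0; have [f [g [gf fg]]] := XY.
  exact: K_zero_retract gf Y0.
by move=> U V YUV; apply: X_indec; exact: K_iso_trans XY YUV.
Qed.

(** A chain endomorphism that kills the socle takes its values in the socle,
    since all arrows have values in the socle, on which the next application
    vanishes. *)
Lemma kills_soc_square X (e : chain_map X X) :
  (forall i v (x : X i v), in_soc x -> e i v x = 0) ->
  forall i v (x : X i v), e i v (e i v x) = 0.
Proof.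
move=> e_soc i v x; apply: (e_soc).
by rewrite /in_soc -hom_arrow e_soc //; exact: arrow_arrow.
Qed.

(** If [a b] is homotopic to the identity and [b a] kills the socle, then the
    identity is homotopic to [a (b a) (b a) b] = 0. *)
Lemma K_zero_factor X (Y : KInj k n) (a : chain_map X Y) (b : chain_map Y X) :
    homotopic (chain_comp a b) (chain_id Y) ->
    (forall i v (x : X i v), in_soc x -> b i v (a i v x) = 0) ->
  K_zero Y.
Proof.
move=> ab ba; have ba2 i v x : b i v (a i v (b i v (a i v x))) = 0 :=
  @kills_soc_square X (chain_comp b a) ba i v x.
set m := chain_comp a b in ab; have id_m := homotopic_sym ab.
have m_mm : homotopic m (chain_comp m m) := homotopic_compl m id_m.
have mm_mmm : homotopic (chain_comp m m) (chain_comp m (chain_comp m m)).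
  exact: (homotopic_comp m m id_m).
apply: homotopic_trans id_m _; apply: homotopic_trans m_mm _.
apply: homotopic_trans mm_mmm _; apply: homotopic_eq => i v x.
by rewrite /= ba2 linear0.
Qed.

(** The socle is a complex of vector spaces.  If it is acyclic it has a linear
    contraction, which extends to the injective modules themselves; the homotopy
    that results deforms the identity into a map that kills the socle, hence
    has square zero. *)
Lemma socle_acyclic_K_zero (X : KInj k n) :
    (forall i j v (x : X j v), i + 1 = j -> in_soc x ->
      differential X j (j + 1) v x = 0 ->
      exists z : X i v, in_soc z /\ differential X i j v z = x) ->
  K_zero X.
Proof.
move=> X_acyclic.
have sections i j v : exists t : {linear X j v -> X i v}, i + 1 = j ->
    forall x, in_soc x -> differential X j (j + 1) v x = 0 ->
    in_soc (t x) /\ differential X i j v (t x) = x.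
  have [e | ij] := eqVneq (i + 1) j; last by exists \0 => /eqP; rewrite (negPf ij).
  pose R (p : X j v * X i v) := in_soc p.2 /\ differential X i j v p.2 = p.1.
  have R_lin : linear_relation R.
    split; first by rewrite /R /in_soc !linear0.
    move=> c [p1 p2] [q1 q2] [/= ps pd] [/= qs qd]; split => /=.
      by have := (soc_subspace (X i) v).2 c _ _ ps qs.
    by rewrite linearP pd qd.
  have [|||G [Glin Gsv _ GR Gtot]] := @linear_selection k _ _ R (fun p => p = 0) R_lin.
  - exact: (subspace_eq0 (idfun : {linear (X j v * X i v)%type -> _})).
  - by move=> w [].
  - by move=> _ ->; exact: R_lin.1.
  have [t tG] := linear_extension Glin Gsv.
  exists t => _ x x_soc dx; have [z [z_soc dz]] := X_acyclic _ _ _ _ e x_soc dx.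
  have [z' Gz'] := Gtot x z (conj z_soc dz).
  by rewrite (tG _ _ Gz'); exact: GR Gz'.
pose t i j v := sval (cid (sections i j v)).
have tP i j v : i + 1 = j -> forall x, in_soc x -> differential X j (j + 1) v x = 0 ->
    in_soc (t i j v x) /\ differential X i j v (t i j v x) = x.
  exact: (svalP (cid (sections i j v))).
(* [t] is a section of the differential on cocycles only; it is applied to the
   cocycle obtained by subtracting from x a preimage of its differential. *)
pose s i j v : {linear X j v -> X i v} :=
  t i j v \o (idfun \- (t j (j + 1) v \o differential X j (j + 1) v)).
have sE i j v x : s i j v x = t i j v (x - t j (j + 1) v (differential X j (j + 1) v x)).
  by [].
have x_rest j v (x : X j v) : in_soc x ->
    let x' := x - t j (j + 1) v (differential X j (j + 1) v x) in
    in_soc x' /\ differential X j (j + 1) v x' = 0.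
  move=> x_soc /=.
  have [|t_soc dt] := tP j (j + 1) v erefl _ (hom_soc (differential X j (j + 1)) x_soc).
    exact: diff_diff.
  by rewrite /in_soc !linearB /= x_soc t_soc dt !subrr.
have extension j i : exists h : rep_hom (X j) (X i), i + 1 = j ->
    forall v x, in_soc x -> h v x = s i j v x.
  have [e | ij] := eqVneq (i + 1) j; last first.
    by exists (zero_hom _ _) => /eqP; rewrite (negPf ij).
  have [|h hs] := @socle_extension k n (X j) (X i) (s i j) (@KInj_injective k n X i).
    move=> v x /x_rest[x'_soc dx']; rewrite sE.
    by have [] := tP i j v e _ x'_soc dx'.
  by exists h.
pose h j i := sval (cid (extension j i)).
have hE j i : i + 1 = j -> forall v x, in_soc x -> h j i v x = s i j v x.
  exact: (svalP (cid (extension j i))).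
pose dh_hd i := add_hom (comp_hom (differential X (i - 1) i) (h i (i - 1)))
  (comp_hom (h (i + 1) i) (differential X i (i + 1))).
have pred_eq i v (x : X (i + 1) v) :
    differential X (i + 1 - 1) (i + 1) v (h (i + 1) (i + 1 - 1) v x)
    = differential X i (i + 1) v (h (i + 1) i v x).
  have : i + 1 - 1 = i by rewrite addrK.
  by move: (i + 1 - 1) => b ->.
have e_comm i j v (x : X i v) :
    sub_hom (id_hom (X j)) (dh_hd j) v (differential X i j v x)
    = differential X i j v (sub_hom (id_hom (X i)) (dh_hd i) v x).
  have [-> | ij] := eqVneq j (i + 1); last by rewrite !diff_shape // linear0.
  by rewrite !sub_homE /= pred_eq (@diff_diff k n X) linear0 addr0 !linearB linearD /=
    (@diff_diff k n X) add0r.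
pose e := @ChainMap k n X X (fun i => sub_hom (id_hom (X i)) (dh_hd i)) e_comm.
have id_e : homotopic (chain_id X) e.
  by exists h => i v x; rewrite [e i v x]sub_homE /= subKr.
have e_soc i v (x : X i v) : in_soc x -> e i v x = 0.
  move=> x_soc; rewrite [e i v x]sub_homE /= !hE ?subrK //; last exact: hom_soc.
  have [x'_soc dx'] := x_rest _ _ _ x_soc.
  have [|_ dt] := tP (i - 1) i v _ _ x'_soc dx'; first by rewrite subrK.
  by rewrite !sE dt diff_diff linear0 subr0 subrK subrr.
apply: homotopic_trans (id_e) _.
apply: homotopic_trans (homotopic_compl e id_e) _.
by apply: homotopic_eq => i v x; exact: kills_soc_square.
Qed.

(** * Split summands *)

Lemma split_complement (X J : KInj k n) (u : chain_map J X) (p : chain_map X J) :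
    (forall i v x, p i v (u i v x) = x) ->
  exists (C : KInj k n) (c : chain_map X C) (b : chain_map C X),
    [/\ forall i v x, b i v (c i v x) = x - u i v (p i v x),
      forall i v x, c i v (b i v x) = x,
      forall i v x, p i v (b i v x) = 0 & forall i v x, c i v (u i v x) = 0].
Proof.
move=> pu.
pose U i v := SubspaceOf (subspace_eq0 (p i v)).
have U_arrow i v x : U i v x -> U i (ordS v) (arrow (X i) v x).
  by rewrite /= hom_arrow => ->; exact: linear0.
pose C i := sub_rep (U_arrow i); pose b i : rep_hom (C i) (X i) := sub_incl (U_arrow i).
have b_inj i v : injective (b i v) by exact: sub_incl_inj.
have pb i v (x : C i v) : p i v (b i v x) = 0 by exact: (sub_inclP x).
have dC_ex i j : exists d : rep_hom (C i) (C j),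
    forall v x, b j v (d v x) = differential X i j v (b i v x).
  apply: (@sub_corestrict k n (X j) (U j) (U_arrow j) (C i)
    (comp_hom (differential X i j) (b i))) => v x /=.
  by rewrite chain_comm [p i v _]pb linear0.
pose dC i j := sval (cid (dC_ex i j)).
have dCE i j v x : b j v (dC i j v x) = differential X i j v (b i v x).
  exact: (svalP (cid (dC_ex i j))).
have dC_shape i j : j != i + 1 -> forall v (x : C i v), dC i j v x = 0.
  by move=> ij v x; apply: b_inj; rewrite dCE diff_shape // linear0.
have dC_diff i j l v (x : C i v) : dC j l v (dC i j v x) = 0.
  by apply: b_inj; rewrite !dCE diff_diff linear0.
have c_ex i : exists c : rep_hom (X i) (C i),
    forall v x, b i v (c v x) = x - u i v (p i v x).
  have [|c cE] := @sub_corestrict k n (X i) (U i) (U_arrow i) (X i)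
    (sub_hom (id_hom (X i)) (comp_hom (u i) (p i))).
    by move=> v x; rewrite sub_homE /= linearB /= pu subrr.
  by exists c => v x; rewrite cE sub_homE.
pose c i := sval (cid (c_ex i)).
have cE i v x : b i v (c i v x) = x - u i v (p i v x).
  exact: (svalP (cid (c_ex i))).
have cb i v x : c i v (b i v x) = x.
  by apply: b_inj; rewrite cE pb linear0 subr0.
have c_comm i j v (x : X i v) : c j v (differential X i j v x) = dC i j v (c i v x).
  by apply: b_inj; rewrite dCE !cE linearB !chain_comm.
have C_inj i : injective_rep (C i).
  exact: (retract_injective (i := b i) (r := c i) (cb i) (@KInj_injective k n X i)).
exists (@MkKInj k n (Cochain dC_shape dC_diff) C_inj).
exists (@ChainMap k n X (Cochain dC_shape dC_diff) c c_comm).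
exists (@ChainMap k n (Cochain dC_shape dC_diff) X b dCE).
by split=> // i v x /=; apply: b_inj; rewrite cE pu subrr linear0.
Qed.

(** The complement of J in X is contractible, and then the idempotent [u p] is
    homotopic to the identity. *)
Lemma indecomposable_split (X J : KInj k n) (u : chain_map J X) (p : chain_map X J) :
    (forall i v x, p i v (u i v x) = x) -> K_indecomposable X -> ~ K_zero J ->
  K_iso X J.
Proof.
move=> pu [_ X_indec] J_neq0.
have [C [c [b [bc cb pb cu]]]] := split_complement pu.
have f_comm i j v (x : X i v) :
    pair_hom (p j) (c j) v (differential X i j v x)
    = differential (K_sum J C) i j v (pair_hom (p i) (c i) v x).
  by congr pair; rewrite /= chain_comm.
pose f : chain_map X (K_sum J C) := @ChainMap k n X (K_sum J C) _ f_comm.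
pose g_hom i : rep_hom (K_sum J C i) (X i) :=
  add_hom (comp_hom (u i) (fst_hom (J i) (C i))) (comp_hom (b i) (snd_hom (J i) (C i))).
have g_comm i j v (x : K_sum J C i v) :
    g_hom j v (differential (K_sum J C) i j v x)
    = differential X i j v (g_hom i v x).
  by rewrite /= linearD !chain_comm.
pose g : chain_map (K_sum J C) X := @ChainMap k n (K_sum J C) X _ g_comm.
have iso : K_iso X (K_sum J C).
  exists f, g; split; apply: homotopic_eq => i v x /=.
    by rewrite bc addrC subrK.
  case: x => x y; congr pair; rewrite /= linearD.
    by rewrite pu pb addr0.
  by rewrite cb cu add0r.
have [//|[h hC]] := X_indec _ _ iso.
exists p, u; split; last by apply: homotopic_eq => i v x; exact: pu.
have bc0 := homotopic_comp b c (ex_intro _ h hC : K_zero C).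
apply: homotopic_sym; move: bc0 => [s sE]; exists s => i v x.
by rewrite -sE /= bc linear0 subr0.
Qed.

End Homotopy.

(** * String complexes *)

(** Splittings of the zigzag of X along the sequence [s] of vertices. *)
Notation complex_splitting X s := (@splitting _ (fun i j => X i (s j))
  (fun i => X i (s i)) (fun i j => arr (X i) (s j) (s i))
  (fun i j => differential X i j (s j))).

Section StringComplexes.

Variables (k : fieldType) (n : nat).
Implicit Types X Y : cochain k n.

(** The truncations of the periodic complex enter the proofs in this form: the
    scalars in the differentials are normalized to 1, and the bounds and the
    shift appear only through [P] and [s]. *)
Record string_complex X (s : int -> 'I_n) (P : pred int)
    (e : forall i, X i (s (i + 1))) (eps : forall i, {linear X i (s i) -> k^o}) :
    Prop := StringComplex {
  string_off : forall i v (x : X i v), ~~ P i -> x = 0;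
  string_on : forall i, P i -> string_module (e i) (eps i);
  string_diff : forall i, P i -> differential X i (i + 1) _ (e i)
    = if P (i + 1) then arr (X (i + 1)) (s (i + 1 + 1)) (s (i + 1)) (e (i + 1)) else 0 }.

Section Properties.

Variables (J : cochain k n) (s : int -> 'I_n) (P : pred int).
Variables (e : forall i, J i (s (i + 1))) (eps : forall i, {linear J i (s i) -> k^o}).
Hypothesis J_string : string_complex P e eps.

Let soc_elt i : J i (s i) := arr (J i) (s (i + 1)) (s i) (e i).

(** The socle is spanned by the images of the generators. *)
Lemma string_soc_ind (Q : forall i v, J i v -> Prop) :
    (forall i v, Q i v 0) -> (forall i c, P i -> Q i (s i) (c *: soc_elt i)) ->
  forall i v x, in_soc x -> Q i v x.
Proof.
move=> Q0 Qsoc i v x x_soc; have [Pi | Pi] := boolP (P i); last first.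
  by rewrite (string_off J_string x Pi).
have [_ soc_neq _ _ socE] := string_on J_string Pi.
have [vs | vs] := eqVneq v (s i); last by rewrite (soc_neq _ _ vs x_soc).
by subst v; rewrite (socE x x_soc); exact: Qsoc.
Qed.

Lemma string_diff_soc i j v (x : J i v) : in_soc x -> differential J i j v x = 0.
Proof.
have [-> | ij] := eqVneq j (i + 1); last by rewrite diff_shape.
move: i v x; apply: string_soc_ind => [i v | i c Pi]; first exact: linear0.
rewrite linearZ /= hom_arr (string_diff J_string) //.
by case: (P _); rewrite ?arr_arr linear0 ?scaler0 // scaler0.
Qed.

(** Homotopies vanish on the socle: the differential kills it, and homomorphisms
    preserve it. *)
Lemma string_homotopic_soc (f g : chain_map J J) : homotopic f g ->
  forall i v (x : J i v), in_soc x -> f i v x = g i v x.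
Proof.
move=> [h fg] i v x x_soc; apply/eqP; rewrite -subr_eq0 fg.
rewrite (string_diff_soc (i + 1) x_soc) linear0 addr0.
by rewrite string_diff_soc //; exact: hom_soc.
Qed.

Lemma string_soc_elt_neq0 i : P i -> soc_elt i <> 0.
Proof.
move=> /(string_on J_string)[_ _ + _ _] ae0.
by rewrite -/(soc_elt i) ae0 linear0 => /esym/eqP; rewrite oner_eq0.
Qed.

Lemma soc_elt_in_soc i : in_soc (soc_elt i).
Proof. exact: in_soc_of_arr. Qed.

Lemma string_complex_neq0 i : P i -> ~ homotopic (chain_id J) (chain_zero J J).
Proof.
move=> Pi J0; apply: (string_soc_elt_neq0 Pi).
exact: string_homotopic_soc J0 _ _ _ (soc_elt_in_soc i).
Qed.

(** A chain endomorphism acts on the socle in degree i by a scalar, and it is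
    the same scalar in all degrees since the differential maps the generator
    in degree i to the socle in degree i + 1. *)
Lemma string_endo_scalar (f : chain_map J J) :
    (forall i j l, i <= j <= l -> P i -> P l -> P j) ->
  exists c : k, forall i v (x : J i v), in_soc x -> f i v x = c *: x.
Proof.
move=> P_convex.
pose c i : k := eps i (f i (s i) (soc_elt i)).
have fE i : P i -> f i (s i) (soc_elt i) = c i *: soc_elt i.
  move=> /(string_on J_string)[_ _ _ _ socE]; apply: socE.
  exact/hom_soc/soc_elt_in_soc.
have cS i : P i -> P (i + 1) -> c (i + 1) = c i.
  move=> Pi Pi1; have [si _ _ _ _] := string_on J_string Pi.
  have rest : in_soc (f i _ (e i) - c i *: e i).
    apply: (@arr_in_soc _ _ _ _ (s i)) => //.
    by rewrite linearB linearZ /= -hom_arr fE // subrr.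
  have := string_diff_soc (i + 1) rest.
  rewrite linearB linearZ /= -chain_comm (string_diff J_string) // Pi1.
  rewrite -/(soc_elt (i + 1)) fE // => /eqP; rewrite -scalerBl scaler_eq0 subr_eq0.
  case/orP => /eqP // e0; by case: (string_soc_elt_neq0 Pi1).
have [[i0 Pi0] | noP] := pselect (exists i, P i); last first.
  exists 0 => i v x _; have Pi : ~~ P i by apply/negP => Pi; case: noP; exists i.
  by rewrite [LHS](string_off J_string _ Pi) scale0r.
exists (c i0); apply: string_soc_ind => [i v | i b Pi].
  by rewrite linear0 scaler0.
rewrite linearZ /= fE // !scalerA mulrC.
by rewrite (interval_constant P_convex cS Pi Pi0).
Qed.

(** The form [eps] turns the zigzag of J into the interval representation. *)
Lemma string_eps_diff i (z : J i (s (i + 1))) : P (i + 1) ->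
  eps (i + 1) (differential J i (i + 1) _ z)
  = if P i then eps i (arr (J i) (s (i + 1)) (s i) z) else 0.
Proof.
move=> Pi1; case: ifPn => [Pi | Pi]; last by rewrite (string_off J_string z Pi) !linear0.
have [si _ _ _ socE] := string_on J_string Pi.
set b : k := eps i _.
have rest : in_soc (z - b *: e i).
  apply: (@arr_in_soc _ _ _ _ (s i)) => //.
  rewrite linearB linearZ /= [arr _ _ _ z]socE; last exact: in_soc_of_arr.
  by rewrite subrr.
have := string_diff_soc (i + 1) rest.
rewrite linearB linearZ /= (string_diff J_string) // Pi1 => /subr0_eq ->.
rewrite linearZ /=; have [_ _ -> _ _] := string_on J_string Pi1.
exact: mulr1.
Qed.

Lemma string_splitting : complex_splitting J s P e eps.
Proof.
split=> [i | i Pi1 x | i Pi]; first exact: (string_diff J_string).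
  exact: string_eps_diff.
by have [] := string_on J_string Pi.
Qed.

(** A splitting of the zigzag of X gives chain maps J -> X -> J whose composite
    w is the identity on the socle.  Then (1 - w)^2 = 0, and 2 - w is inverse
    to w. *)
Lemma string_split X (ys : forall i, X i (s (i + 1)))
    (fs : forall i, {linear X i (s i) -> k^o}) :
    complex_splitting X s P ys fs ->
  exists (u : chain_map J X) (p : chain_map X J),
    forall i v x, p i v (u i v x) = x.
Proof.
move=> [ysS fsS fys].
have u_ex i : exists u : rep_hom (J i) (X i), P i -> u _ (e i) = ys i.
  have [Pi | Pi] := boolP (P i); last by exists (zero_hom _ _).
  by have [u] := string_hom_from (string_on J_string Pi) (ys i); exists u.
pose u i := sval (cid (u_ex i)).
have uE i : P i -> u i _ (e i) = ys i by exact: (svalP (cid (u_ex i))).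
have p_ex i : exists p : rep_hom (X i) (J i), P i -> forall x, eps i (p _ x) = fs i x.
  have [Pi | Pi] := boolP (P i); last by exists (zero_hom _ _).
  by have [p] := string_hom_to (string_on J_string Pi) (fs i); exists p.
pose p i := sval (cid (p_ex i)).
have pE i : P i -> forall x, eps i (p i _ x) = fs i x by exact: (svalP (cid (p_ex i))).
have u_comm i j v (x : J i v) :
    u j v (differential J i j v x) = differential X i j v (u i v x).
  have [-> | ij] := eqVneq j (i + 1); last by rewrite !diff_shape // linear0.
  have [Pi | Pi] := boolP (P i); last by rewrite (string_off J_string x Pi) !linear0.
  apply: (string_hom_from_eq (string_on J_string Pi)
    (f := comp_hom (u (i + 1)) (differential J i (i + 1)))
    (g := comp_hom (differential X i (i + 1)) (u i))).
  rewrite /= (string_diff J_string) // uE // ysS //.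
  by case: ifP => [Pi1 | _]; [rewrite hom_arr uE | exact: linear0].
have p_comm i j v (x : X i v) :
    p j v (differential X i j v x) = differential J i j v (p i v x).
  have [-> | ij] := eqVneq j (i + 1); last by rewrite !diff_shape // linear0.
  have [Pi1 | Pi1] := boolP (P (i + 1)); last first.
    by rewrite [LHS](string_off J_string _ Pi1) [RHS](string_off J_string _ Pi1).
  apply: (string_hom_to_eq (string_on J_string Pi1)
    (f := comp_hom (p (i + 1)) (differential X i (i + 1)))
    (g := comp_hom (differential J i (i + 1)) (p i))) => {}x /=.
  rewrite pE // fsS // string_eps_diff //.
  by case: ifP => // Pi; rewrite -hom_arr pE.
pose uC := @ChainMap k n J X u u_comm; pose pC := @ChainMap k n X J p p_comm.
pose w := chain_comp pC uC.
have w_soc i v (x : J i v) : in_soc x -> w i v x = x.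
  move: i v x; apply: string_soc_ind => [i v | i c Pi]; first exact: linear0.
  rewrite linearZ /=; congr (_ *: _).
  have [_ _ _ _ socE] := string_on J_string Pi.
  rewrite [LHS]socE; last exact/hom_soc/hom_soc/soc_elt_in_soc.
  by rewrite pE // hom_arr uE // fys // scale1r.
pose r := chain_sub w (chain_id J).
have r_soc i v (x : J i v) : in_soc x -> r i v x = 0.
  by move=> x_soc; rewrite [r i v x]sub_homE w_soc // subrr.
have rr i v (x : J i v) : r i v (r i v x) = 0 by exact: kills_soc_square.
exists uC, (chain_sub pC (chain_comp r pC)) => i v x.
transitivity (w i v x - r i v (w i v x)); first exact: sub_homE.
have -> : w i v x = x + r i v x by rewrite [r i v x]sub_homE addrC subrK.
by rewrite linearD rr addr0 addrK.
Qed.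

End Properties.

(** If J is a direct sum of Y and Z, the projections act on the socle of J by
    scalars c and c' with c + c' = 1 and c * c = c; the summand whose scalar is 0
    vanishes. *)
Lemma string_K_indecomposable (J : KInj k n) (s : int -> 'I_n) (P : pred int)
    (e : forall i, J i (s (i + 1))) (eps : forall i, {linear J i (s i) -> k^o}) i0 :
    string_complex P e eps -> (forall i j l, i <= j <= l -> P i -> P l -> P j) ->
    P i0 ->
  K_indecomposable J.
Proof.
move=> J_string P_convex Pi0; split; first exact: (string_complex_neq0 J_string Pi0).
move=> Y Z [f [g [gf fg]]].
have a_comm i j v (x : J i v) :
    comp_hom (fst_hom (Y j) (Z j)) (f j) v (differential J i j v x)
    = differential Y i j v (comp_hom (fst_hom (Y i) (Z i)) (f i) v x).
  exact: (congr1 fst (chain_comm f j x)).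
pose a : chain_map J Y := ChainMap a_comm.
have a'_comm i j v (x : J i v) :
    comp_hom (snd_hom (Y j) (Z j)) (f j) v (differential J i j v x)
    = differential Z i j v (comp_hom (snd_hom (Y i) (Z i)) (f i) v x).
  exact: (congr1 snd (chain_comm f j x)).
pose a' : chain_map J Z := ChainMap a'_comm.
have b_comm i j v (y : Y i v) :
    comp_hom (g j) (pair_hom (id_hom (Y j)) (zero_hom (Y j) (Z j))) v
      (differential Y i j v y)
    = differential J i j v
        (comp_hom (g i) (pair_hom (id_hom (Y i)) (zero_hom (Y i) (Z i))) v y).
  rewrite -[RHS](chain_comm g j ((y, 0) : K_sum Y Z i v)).
  by congr (g j v _); congr pair; rewrite /= linear0.
pose b : chain_map Y J := ChainMap b_comm.
have b'_comm i j v (y : Z i v) :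
    comp_hom (g j) (pair_hom (zero_hom (Z j) (Y j)) (id_hom (Z j))) v
      (differential Z i j v y)
    = differential J i j v
        (comp_hom (g i) (pair_hom (zero_hom (Z i) (Y i)) (id_hom (Z i))) v y).
  rewrite -[RHS](chain_comm g j ((0, y) : K_sum Y Z i v)).
  by congr (g j v _); congr pair; rewrite /= linear0.
pose b' : chain_map Z J := ChainMap b'_comm.
have ab : homotopic (chain_comp a b) (chain_id Y).
  move: fg => [h hE]; exists (fun i j => comp_hom (fst_hom _ _)
    (comp_hom (h i j) (pair_hom (id_hom (Y i)) (zero_hom (Y i) (Z i))))) => i v y.
  have := congr1 fst (hE i v (y, 0)) => /= ->.
  congr (_ + (h (i + 1) i v _).1); congr pair; exact: linear0.
have ab' : homotopic (chain_comp a' b') (chain_id Z).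
  move: fg => [h hE]; exists (fun i j => comp_hom (snd_hom _ _)
    (comp_hom (h i j) (pair_hom (zero_hom (Z i) (Y i)) (id_hom (Z i))))) => i v y.
  have := congr1 snd (hE i v (0, y)) => /= ->.
  congr (_ + (h (i + 1) i v _).2); congr pair; exact: linear0.
have sum_soc i v (x : J i v) : in_soc x -> b i v (a i v x) + b' i v (a' i v x) = x.
  move=> x_soc; rewrite /= -linearD.
  rewrite -[RHS](string_homotopic_soc J_string gf x_soc) /=.
  by congr (g i v _); case: (f i v x) => y z; congr pair; rewrite /= ?addr0 ?add0r.
have [c cE] := string_endo_scalar J_string (chain_comp b a) P_convex.
have [c' cE'] := string_endo_scalar J_string (chain_comp b' a') P_convex.
pose x0 := arr (J i0) (s (i0 + 1)) (s i0) (e i0).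
have x0_soc : in_soc x0 by exact: in_soc_of_arr.
have x0_neq0 : x0 != 0 by apply/eqP; exact: (string_soc_elt_neq0 J_string Pi0).
have cc' : c + c' = 1.
  have := sum_soc _ _ _ x0_soc.
  rewrite [b _ _ _](cE _ _ _ x0_soc) [b' _ _ _](cE' _ _ _ x0_soc) -scalerDl.
  rewrite -[RHS]scale1r => /eqP; rewrite -subr_eq0 -scalerBl scaler_eq0.
  by rewrite (negPf x0_neq0) orbF subr_eq0 => /eqP.
have c_idem : c * c = c.
  have : chain_comp b a _ _ (chain_comp b a _ _ x0) = chain_comp b a _ _ x0.
    exact: (string_homotopic_soc J_string (homotopic_comp b a ab) x0_soc).
  rewrite (cE _ _ _ x0_soc) linearZZ (cE _ _ _ x0_soc) scalerA.
  move=> /eqP; rewrite -subr_eq0 -scalerBl scaler_eq0.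
  by rewrite (negPf x0_neq0) orbF subr_eq0 => /eqP.
have [c0 | c_neq0] := eqVneq c 0.
  left; apply: K_zero_factor ab _ => i v x x_soc.
  by rewrite [b _ _ _](cE _ _ _ x_soc) c0 scale0r.
have c1 : c = 1 by apply: (mulfI c_neq0); rewrite c_idem mulr1.
right; apply: K_zero_factor ab' _ => i v x x_soc.
rewrite [b' _ _ _](cE' _ _ _ x_soc).
by move: cc'; rewrite c1 => /(canRL (addKr _)); rewrite addNr => ->; rewrite scale0r.
Qed.

(** A homotopy equivalence is injective on the socle. *)
Lemma string_iso_support (J J' : KInj k n) (s s' : int -> 'I_n) (P P' : pred int)
    (e : forall i, J i (s (i + 1))) (eps : forall i, {linear J i (s i) -> k^o})
    (e' : forall i, J' i (s' (i + 1))) (eps' : forall i, {linear J' i (s' i) -> k^o}) :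
    string_complex P e eps -> string_complex P' e' eps' -> K_iso J J' ->
  forall i, P i -> P' i /\ s i = s' i.
Proof.
move=> J_string J'_string [f [g [gf _]]] i Pi.
set x := arr (J i) (s (i + 1)) (s i) (e i).
have x_soc : in_soc x by exact: in_soc_of_arr.
have gfx : g _ _ (f _ _ x) = x by exact: (string_homotopic_soc J_string gf x_soc).
have fx0 : f i _ x <> 0.
  move=> fx0; apply: (string_soc_elt_neq0 J_string Pi).
  by rewrite -[LHS]gfx fx0 linear0.
have P'i : P' i.
  by apply: contrapT => /negP P'i; apply: fx0; exact: (string_off J'_string).
split=> //; apply: contrapT => /eqP ss'; apply: fx0.
have [_ soc_neq _ _ _] := string_on J'_string P'i.
exact/(soc_neq _ _ ss')/hom_soc.
Qed.

End StringComplexes.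

(** * Extended integer intervals *)

Lemma in_interval_shift (L M : \bar int) (D i : int) :
  in_interval (L + D%:E)%E (M + D%:E)%E (i + D) = in_interval L M i.
Proof.
by rewrite /in_interval EFinD !leeD2rE.
Qed.

Lemma trunc_bounds_nonempty l m : trunc_bounds l m -> exists i, in_interval l m i.
Proof.
rewrite /in_interval.
case; case: l => [a | // | ]; case: m => [b | | //] _ _.
- by rewrite lee_fin => ab; exists a; rewrite !lee_fin lexx.
- by exists a; rewrite lexx leey.
- by exists b; rewrite lexx leNye.
- by exists 0; rewrite leNye leey.
Qed.

Lemma lower_bound_inj (j : int) (L L' : \bar int) :
    (L <= j%:E)%E -> (L' <= j%:E)%E ->
    (forall i, i <= j -> (L <= i%:E)%E = (L' <= i%:E)%E) ->
  L = L'.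
Proof.
case: L => [a | // | ]; case: L' => [b | // | ] //; rewrite ?lee_fin.
- move=> aj bj ab; congr EFin; apply/le_anti.
  by have := ab _ aj; have := ab _ bj; rewrite !lee_fin !lexx => -> <-.
- by move=> aj _ /(_ (a - 1)); rewrite leNye lee_fin; lia.
- by move=> _ bj /(_ (b - 1)); rewrite leNye lee_fin; lia.
Qed.

Lemma upper_bound_inj (j : int) (M M' : \bar int) :
    (j%:E <= M)%E -> (j%:E <= M')%E ->
    (forall i, j <= i -> (i%:E <= M)%E = (i%:E <= M')%E) ->
  M = M'.
Proof.
case: M => [a | | //]; case: M' => [b | | //] //; rewrite ?lee_fin.
- move=> aj bj ab; congr EFin; apply/le_anti.
  by have := ab _ aj; have := ab _ bj; rewrite !lee_fin !lexx => -> <-.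
- by move=> aj _ /(_ (a + 1)); rewrite leey lee_fin; lia.
- by move=> _ bj /(_ (b + 1)); rewrite leey lee_fin; lia.
Qed.

Lemma in_interval_inj (L M L' M' : \bar int) j : in_interval L M j ->
  in_interval L M =1 in_interval L' M' -> L = L' /\ M = M'.
Proof.
move=> Lj LL'; have L'j := Lj; rewrite LL' in L'j.
case/andP: Lj => Lj jM; case/andP: L'j => L'j jM'.
split.
  apply: lower_bound_inj Lj L'j _ => i ij.
  have := LL' i; rewrite /in_interval.
  have -> : (i%:E <= M)%E by apply: le_trans jM; rewrite lee_fin.
  have -> : (i%:E <= M')%E by apply: le_trans jM'; rewrite lee_fin.
  by rewrite !andbT.
apply: upper_bound_inj jM jM' _ => i ij.
have := LL' i; rewrite /in_interval.
have -> : (L <= i%:E)%E by apply: le_trans Lj _; rewrite lee_fin.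
by have -> : (L' <= i%:E)%E by apply: le_trans L'j _; rewrite lee_fin.
Qed.

(** * The truncations of the periodic complex *)

Section Truncations.

Variables (k : fieldType) (n : nat).

Lemma top_to_radical_scale (M N : rep k n) (a : k) (f : rep_hom M N) :
  a != 0 -> top_to_radical f -> top_to_radical (scale_hom a f).
Proof.
move=> a0 [f_ker f_im]; split=> [v x | v y].
  rewrite -f_ker /=; split=> [/eqP | ->]; last exact: scaler0.
  by rewrite scaler_eq0 (negPf a0) => /eqP.
rewrite f_im; split=> -[x fx]; last by exists (a *: x); rewrite linearZZ.
by exists (a^-1 *: x); rewrite /= linearZZ scalerA mulfV // scale1r.
Qed.

Lemma trunc_top_to_radical (M N : rep k n) (b c : bool) (f : rep_hom M N) :
  b -> c -> top_to_radical f -> top_to_radical (trunc_hom b c f).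
Proof. by case: b; case: c. Qed.

Variables (n_gt0 : (0 < n)%N).

Lemma residue_ord (w : 'I_n) : residue n_gt0 w%:Z = w.
Proof. by apply: val_inj; rewrite /= modz_nat modn_small. Qed.

Lemma residue_shift (a q : int) : residue n_gt0 (a + n%:Z * q) = residue n_gt0 a.
Proof. by apply: val_inj; rewrite /= mulrC addrC modzMDl. Qed.

Lemma residue_eq (a b : int) : residue n_gt0 a = residue n_gt0 b ->
  exists q, b = a + n%:Z * q.
Proof.
move=> /(congr1 val) /= /eqP; rewrite -eqz_nat !gez0_abs ?modz_ge0 ?eqz_nat -?lt0n //.
rewrite eq_sym => /eqP ab; exists ((b - a) %/ n%:Z)%Z.
rewrite mulrC divzK; first by rewrite addrC subrK.
by apply/dvdz_mod0P; move/eqP: ab; rewrite eqz_mod_dvd => /dvdz_mod0P.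
Qed.

(** The vertex of the socle in degree i of the periodic complex shifted by
    r. *)
Definition site (r i : int) : 'I_n := residue n_gt0 (1 - (i + r)).

Lemma site_succ r i : site r i = ordS (site r (i + 1)).
Proof. by rewrite /site -residueS; congr residue; ring. Qed.

Lemma site_surj i (w : 'I_n) : exists r, site r i = w.
Proof.
exists (1 - i - w%:Z); rewrite -[RHS]residue_ord /site; congr residue; ring.
Qed.

Variables (I : 'I_n -> rep k n) (d : forall j, rep_hom (I (ordS j)) (I j)).
Hypothesis I_injective : forall j, indecomposable_injective_at j (I j).
Hypothesis d_composite : forall j, top_to_radical (d j).

Lemma step_top_to_radical i j : ordS j = i -> top_to_radical (step_hom d i j).
Proof. by move=> <-; rewrite step_homE. Qed.

Section OneTruncation.

Variables (l m : \bar int) (r : int).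

Let J : KInj k n := K_shift (I_trunc n_gt0 I_injective d_composite l m) r.
Let P : pred int := fun i => (l <= (i + r)%:E <= m)%E.

Lemma truncation_diff i : P i -> P (i + 1) -> top_to_radical (differential J i (i + 1)).
Proof.
move=> Pi Pi1; apply: top_to_radical_scale.
  by rewrite expfz_neq0 // oppr_eq0 oner_eq0.
apply: trunc_top_to_radical => //.
rewrite /= /periodic_diff addrAC eqxx; apply: step_top_to_radical.
by rewrite -residueS; congr residue; ring.
Qed.

Lemma truncation_zero i v (x : J i v) : ~~ P i -> x = 0.
Proof.
move: x; rewrite /J /= /trunc_term -/(P i) => x Pi; move: x.
by rewrite (negPf Pi) => x; rewrite [LHS]thinmx0 [RHS]thinmx0.
Qed.

Lemma truncation_socle i : P i -> simple_socle_at (J i) (site r i).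
Proof.
by rewrite /J /= /trunc_term -/(P i) => ->; have [] := I_injective (site r i).
Qed.

Lemma truncation_generator i : P i ->
  exists e : J i (site r (i + 1)), arr (J i) _ (site r i) e <> 0.
Proof.
move=> Pi; have [_ [x x0 x_soc]] := truncation_socle Pi.
have [|||e ex] := @soc_in_image k n (J i) (site r (i + 1)) (site r i) x.
- exact: (@KInj_injective k n J i).
- by rewrite -site_succ.
- by apply/x_soc; exists 1; rewrite scale1r.
by exists e; rewrite ex; exact/eqP.
Qed.

(** The maps d_j are given up to scalars, and the shift changes signs.  All
    these scalars are absorbed into the generators, which are chosen one degree
    after the other in both directions. *)
Lemma truncation_string : trunc_bounds l m ->
  (exists i, P i) /\
  exists e (eps : forall i, {linear J i (site r i) -> k^o}),
    @string_complex k n J (site r) P e eps.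
Proof.
move=> bounds; have [i0 Pi0] : exists i, P i.
  have [a la] := trunc_bounds_nonempty bounds; exists (a - r).
  by rewrite /P subrK.
split; first by exists i0.
have [e0 e0_neq0] := truncation_generator Pi0.
have [||| e [_ e_gen eS]] := @int_dependent_choice (fun i => J i (site r (i + 1)))
  (fun i y => P i -> arr (J i) _ (site r i) y <> 0)
  (fun i y y' => P i -> P (i + 1) -> differential J i (i + 1) _ y
     = arr (J (i + 1)) (site r (i + 1 + 1)) _ y')
  (fun _ => 0) i0 e0.
- by [].
- move=> i y _ y_gen; have [Pi1 | Pi1] := boolP (P (i + 1)); last first.
    by exists 0; split=> // _ /(negP Pi1).
  have [Pi | Pi] := boolP (P i); last first.
    by have [y' y'_gen] := truncation_generator Pi1; exists y'.
  have [d_ker d_im] := truncation_diff Pi Pi1.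
  have dy_rad : in_rad (differential J i (i + 1) _ y) by apply/d_im; exists y.
  have [y' ay'] := in_rad_arr (esym (site_succ r (i + 1))) dy_rad.
  exists y'; split=> // _; rewrite ay' => /d_ker y_soc.
  by apply: (y_gen Pi); exact: in_soc_arr.
- move=> i y' _ y'_gen; have [Pi | Pi] := boolP (P i); last first.
    by exists 0; split=> Pi'; case/negP: Pi.
  have [Pi1 | Pi1] := boolP (P (i + 1)); last first.
    have [y y_gen] := truncation_generator Pi.
    by exists y; split=> // _ /(negP Pi1).
  have [d_ker d_im] := truncation_diff Pi Pi1.
  have /d_im[y dy] : in_rad (arr (J (i + 1)) (site r (i + 1 + 1)) (site r (i + 1)) y').
    by apply: arr_in_rad; rewrite -site_succ.
  exists y; split=> // _ ay0; apply: (y'_gen Pi1); rewrite -dy; apply/d_ker.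
  by apply: arr_in_soc ay0; rewrite -site_succ.
have eps_ex i : exists eps : {linear J i (site r i) -> k^o},
    P i -> string_module (e i) eps.
  have [Pi | Pi] := boolP (P i); last by exists \0 => Pi'; case/negP: Pi.
  have [|eps] := @simple_socle_string k n (J i) _ _ (e i)
    (esym (site_succ r i)) (truncation_socle Pi).
    by apply/eqP; exact: e_gen.
  by exists eps.
exists e, (fun i => sval (cid (eps_ex i))); split.
- by move=> i v x; exact: truncation_zero.
- by move=> i; exact: (svalP (cid (eps_ex i))).
move=> i Pi; case: ifPn => [Pi1 | Pi1]; first exact: eS.
exact: truncation_zero.
Qed.

End OneTruncation.

End Truncations.

(** * The classification *)

Section Classification.

Variables (k : fieldType) (n : nat) (n_gt0 : (0 < n)%N).

(** The injectivity of the terms enters through the fact that every element of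
    the socle is an image of an arrow: it lifts cocycles from A to T, and yields
    the two hypotheses on the zigzag. *)
Lemma socle_class_splitting (X : KInj k n) i j v (x : X j v) :
    i + 1 = j -> in_soc x -> differential X j (j + 1) v x = 0 ->
    ~ (exists z : X i v, in_soc z /\ differential X i j v z = x) ->
  let s r := site n_gt0 r in
  exists r L M ys fs j0, [/\ L <> +oo%E, M <> -oo%E, in_interval L M j0 &
    complex_splitting X (s r) (in_interval L M) ys fs].
Proof.
move=> ij x_soc dx x_notB s; have [r sv] := site_surj n_gt0 j v.
subst v; exists r.
have sS l : ordS (s r (l + 1)) = s r l by rewrite /s -site_succ.
have X_im l v (y : X l v) w : ordS w = v -> in_soc y -> exists z, arr (X l) w v z = y.
  by move=> wv; apply: soc_in_image wv; exact: (@KInj_injective k n X l).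
have [y0 ay0] := X_im _ _ _ _ (sS j) x_soc.
have [y1 ay1] : exists y1, arr (X (j + 1)) (s r (j + 1 + 1)) (s r (j + 1)) y1
    = differential X j (j + 1) _ y0.
  apply: (X_im _ _ _ _ (sS _)); apply: arr_in_soc (sS j) _.
  by rewrite -hom_arr ay0.
apply: zigzag_splitting ay1 _.
- move=> l z az; have z_soc := arr_in_soc (sS l) az.
  have [z' az'] := X_im _ _ _ _ (sS (l + 1)) z_soc.
  exists (differential X l (l + 1) _ z'); rewrite diff_diff; split=> //.
  by rewrite -hom_arr az'.
- move=> l y y' ay'; apply: (X_im _ _ _ _ (sS _)).
  apply: arr_in_soc (sS (l + 1)) _.
  by rewrite -hom_arr ay' diff_diff.
move=> [i' [z [i'j az dz]]]; apply: x_notB.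
have e : i' = i by lia.
subst i' j; exists z; split; first exact: arr_in_soc (sS i) az.
by rewrite dz.
Qed.

Variables (I : 'I_n -> rep k n) (d : forall j, rep_hom (I (ordS j)) (I j)).
Hypothesis I_injective : forall j, indecomposable_injective_at j (I j).
Hypothesis d_composite : forall j, top_to_radical (d j).

Let J l m r : KInj k n := K_shift (I_trunc n_gt0 I_injective d_composite l m) r.
Let P l m r : pred int := fun i => in_interval l m (i + r).

Let J_string l m r : trunc_bounds l m -> (exists i, P l m r i) /\
  exists e (eps : forall i, {linear J l m r i (site n_gt0 r i) -> k^o}),
    string_complex (P l m r) e eps.
Proof. exact: truncation_string. Qed.

Lemma truncation_indecomposable l m r : trunc_bounds l m -> K_indecomposable (J l m r).
Proof.
move=> lm; have [[i0 Pi0] [e [eps J_str]]] :=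
  J_string r lm.
apply: (string_K_indecomposable J_str) Pi0.
by move=> i j b ijb; apply: in_interval_convex; lia.
Qed.

Lemma indecomposable_truncation (X : KInj k n) : K_indecomposable X ->
  exists (l m : \bar int) (r : int), trunc_bounds l m /\ K_iso X (J l m r).
Proof.
move=> X_indec; have [X_neq0 _] := X_indec.
have [i [j [v [x [ij x_soc dx x_notB]]]]] : exists i j v (x : X j v),
    [/\ i + 1 = j, in_soc x, differential X j (j + 1) v x = 0
      & ~ (exists z : X i v, in_soc z /\ differential X i j v z = x)].
  apply: contrapT => no_class; apply: X_neq0; apply: socle_acyclic_K_zero.
  move=> i j v x ij x_soc dx; apply: contrapT => x_notB.
  by apply: no_class; exists i, j, v, x.
have [r [L [M [ys [fs [j0 [L_fin M_fin LMj split_X]]]]]]] :=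
  socle_class_splitting ij x_soc dx x_notB.
pose l := (L + r%:E)%E; pose m := (M + r%:E)%E.
have PE : P l m r = in_interval L M by apply/funext => b; exact: in_interval_shift.
have lm : trunc_bounds l m.
  split; rewrite /l /m.
  - by move: L_fin; case: (L).
  - by move: M_fin; case: (M).
  - have := LMj; rewrite -(in_interval_shift L M r) => /andP[]; exact: le_trans.
have [_ [e [eps J_str]]] := J_string r lm.
rewrite -PE in split_X.
have [u [p pu]] := string_split J_str split_X.
exists l, m, r; split=> //.
apply: (indecomposable_split pu X_indec).
by have [] := truncation_indecomposable r lm.
Qed.

(** A complex with the same socle as J splits off from J, which is
    indecomposable. *)
Lemma truncation_iso l m r l' m' r' : trunc_bounds l m -> trunc_bounds l' m' ->
  site n_gt0 r' = site n_gt0 r -> P l' m' r' = P l m r ->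
  K_iso (J l m r) (J l' m' r').
Proof.
move=> lm l'm' sE PE.
have [_ [e [eps J_str]]] := J_string r lm.
have [_] := J_string r' l'm'.
rewrite sE PE => -[e' [eps' J'_str]].
have [u [p pu]] := string_split J'_str (string_splitting J_str).
apply: (indecomposable_split pu (truncation_indecomposable r lm)).
by have [] := truncation_indecomposable r' l'm'.
Qed.

Lemma truncation_iso_inv l m r l' m' r' : trunc_bounds l m -> trunc_bounds l' m' ->
  K_iso (J l m r) (J l' m' r') ->
  exists q : int, [/\ l' = (l + (n%:Z * q)%:E)%E, m' = (m + (n%:Z * q)%:E)%E &
    r' = r + n%:Z * q].
Proof.
move=> lm l'm' JJ'.
have [[i0 Pi0] [e [eps J_str]]] := J_string r lm.
have [_ [e' [eps' J'_str]]] := J_string r' l'm'.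
have sub := string_iso_support J_str J'_str JJ'.
have sup := string_iso_support J'_str J_str (K_iso_sym JJ').
have [_ /esym/residue_eq[q rq]] := sub i0 Pi0.
have r'E : r' = r + n%:Z * q by lia.
have [||lE mE] := @in_interval_inj l' m' (l + (n%:Z * q)%:E)%E
  (m + (n%:Z * q)%:E)%E (i0 + r').
- by have [] := sub i0 Pi0.
- move=> b; have -> : b = (b - r' + r) + n%:Z * q by lia.
  rewrite in_interval_shift -addrA -r'E.
  apply/idP/idP => [/sup[] // | /sub[] //].
by exists q.
Qed.

End Classification.

Theorem theorem3p2 (k : closedFieldType) (n : nat) (n_gt0 : (0 < n)%N)
    (I : 'I_n -> rep k n) (d : forall j : 'I_n, rep_hom (I (ordS j)) (I j))
    (I_inj : forall j : 'I_n, indecomposable_injective_at j (I j))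
    (d_comp : forall j : 'I_n, top_to_radical (d j)) :
  let J (l m : \bar int) (r : int) : KInj k n :=
    K_shift (I_trunc n_gt0 I_inj d_comp l m) r in
  (forall X : KInj k n,
     K_indecomposable X <->
     exists (l m : \bar int) (r : int), trunc_bounds l m /\ K_iso X (J l m r))
  /\
  (forall (l m l' m' : \bar int) (r r' : int),
     trunc_bounds l m -> trunc_bounds l' m' ->
     (K_iso (J l m r) (J l' m' r') <->
      exists q : int,
        [/\ l' = (l + (n%:Z * q)%:E)%E,
            m' = (m + (n%:Z * q)%:E)%E &
            r' = r + n%:Z * q])).
Proof.
move=> J; split=> [X | l m l' m' r r' lm l'm'].
  split; first exact: indecomposable_truncation.
  move=> [l [m [r [lm XJ]]]]; apply: K_indecomposable_iso (K_iso_sym XJ) _.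
  exact: truncation_indecomposable.
split; first exact: truncation_iso_inv.
move=> [q [lE mE rE]]; apply: truncation_iso => //; apply/funext => i.
  rewrite /site rE -(residue_shift n_gt0 (1 - (i + (r + n%:Z * q))) q).
  by congr residue; ring.
by rewrite lE mE rE addrA in_interval_shift.
Qed.
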